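(* Let $\mathcal{A}$ be a finite set and let $\{\varphi_i(x)=rx+t_i\}_{i\in\mathcal{A}}$ be an equicontractive iterated function system on $\mathbb{R}$ (with common ratio $r\in(-1,0)\cup(0,1)$) satisfying the convex strong separation condition and whose self-similar set $X$ is contained in $[1,\infty)$. Let $(f_n)_{n=1}^{\infty}$ be a sequence of functions satisfying: A. $f_n\in C^3(\mathrm{conv}(X),\mathbb{R})$ for each $n$. B. There exist $C_1,C_2>0$ such that for any $m,n$ with $m<n$ we have $|f_n'(x)-f_m'(x)|\le C_1n^{C_2}x^{n-1}$ for all $x\in\mathrm{conv}(X)$. C. There exists $C_3>0$ such that for all $n$ sufficiently large, for any $m<n$ we have $|f_n''(x)-f_m''(x)|\ge C_3x^{n-2}$ for all $x\in\mathrm{conv}(X)$. D. For any $m,n$ with $m<n$, either $f_n'''(x)-f_m'''(x)\ge 0$ for all $x\in\mathrm{conv}(X)$, or $f_n'''(x)-f_m'''(x)\le 0$ for all $x\in\mathrm{conv}(X)$. Moreover, let $(p_i)_{i\in\mathcal{A}}$ be a probability vector satisfying $$\frac12<\frac{-\sum_{i\in\mathcal{A}}p_i\log p_i}{-\log|r|}.$$ Let $\mu$ be the self-similar measure corresponding to $\{\varphi_i\}_{i\in\mathcal{A}}$ and $(p_i)_{i\in\mathcal{A}}$. Then for $\mu$-almost every $x$ the sequence $(f_n(x))_{n=1}^{\infty}$ is uniformly distributed modulo one.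
   Context: An iterated function system (IFS) is a finite set $\{\varphi_i\}_{i\in\mathcal{A}}$ of maps $\varphi_i:\mathbb{R}\to\mathbb{R}$, $\varphi_i(x)=r_ix+t_i$ with $r_i\in(-1,0)\cup(0,1)$ and $t_i\in\mathbb{R}$. It is equicontractive if all $r_i$ are equal to a common value $r$. Its self-similar set is the unique non-empty compact set $X\subset\mathbb{R}$ with $X=\bigcup_{i\in\mathcal{A}}\varphi_i(X)$. The IFS satisfies the convex strong separation condition if $\varphi_i(\mathrm{conv}(X))\cap\varphi_j(\mathrm{conv}(X))=\emptyset$ for all $i\neq j$, where $\mathrm{conv}(X)$ is the convex hull of $X$. $C^3(\mathrm{conv}(X),\mathbb{R})$ denotes the set of three times differentiable functions from $\mathrm{conv}(X)$ to $\mathbb{R}$. For a probability vector $\mathbf{p}=(p_i)_{i\in\mathcal{A}}$ ($p_i\ge 0$, $\sum_i p_i=1$), the corresponding self-similar measure is the unique Borel probability measure $\mu$ on $\mathbb{R}$ with $\mu=\sum_{i\in\mathcal{A}}p_i\cdot\mu\circ\varphi_i^{-1}$. The convention $0\log 0=0$ is used. The indices $m,n$ are positive integers. A real sequence $(x_n)_{n=1}^\infty$ is uniformly distributed modulo one if for all $0\le u<v\le 1$, $\lim_{N\to\infty}\frac1N\#\{1\le n\le N: x_n \bmod 1\in[u,v]\}=v-u$. *)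

(* Defs.v *)
From HB Require Import structures.
From mathcomp Require Import all_boot all_order all_algebra.
From mathcomp Require Import all_classical all_reals all_analysis.

Set Implicit Arguments.
Unset Strict Implicit.
Unset Printing Implicit Defensive.

Import Order.TTheory GRing.Theory Num.Theory.
Import numFieldNormedType.Exports.

Local Open Scope classical_set_scope.
Local Open Scope ring_scope.

Definition convex_hull (R : realType) (X : set R) : set R :=
  smallest (@convex_set R R^o) X.

Definition equicontractive_ifs (R : realType) (A : finType) (r : R)
    (t : A -> R) : A -> R -> R :=
  fun i x => r * x + t i.

(* For an iterated function system this determines X uniquely. *)
Definition is_self_similar_set (R : realType) (A : finType)
    (phi : A -> R -> R) (X : set R) : Prop :=
  [/\ X !=set0, compact X & X = \bigcup_(i in [set: A]) (phi i @` X)].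

Definition convex_strong_separation (R : realType) (A : finType)
    (phi : A -> R -> R) (X : set R) : Prop :=
  forall i j : A, i != j ->
    (phi i @` convex_hull X) `&` (phi j @` convex_hull X) = set0.

Definition probability_vector (R : realType) (A : finType) (p : A -> R) : Prop :=
  (forall i, 0 <= p i) /\ \sum_(i : A) p i = 1.

(* For an iterated function system this determines mu uniquely. *)
Definition is_self_similar_measure (R : realType) (A : finType)
    (phi : A -> R -> R) (p : A -> R)
    (mu : probability (measurableTypeR R) R) : Prop :=
  forall B : set (measurableTypeR R), measurable B ->
    mu B = (\sum_(i : A) (p i)%:E * pushforward mu (phi i) B)%E.

(* Since [ln 0 = 0] and [0 * _ = 0], the convention 0 log 0 = 0 holds. *)
Definition entropy (R : realType) (A : finType) (p : A -> R) : R :=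
  - \sum_(i : A) p i * ln (p i).

(* The difference quotients only see the values of g on D: a function D -> R is
   represented by an arbitrary extension to R, and derivatives are one-sided at
   the endpoints when D is a compact interval. *)
Definition differentiable_on (R : realType) (D : set R) (g : R -> R) : Prop :=
  forall x, D x -> cvg ((g y - g x) / (y - x) @[y --> within D x^']).

Definition derive_on (R : realType) (D : set R) (g : R -> R) : R -> R :=
  fun x => lim ((g y - g x) / (y - x) @[y --> within D x^']).

Definition derive_on_n (R : realType) (D : set R) (k : nat) (g : R -> R) :
    R -> R :=
  iter k (derive_on D) g.

(* The class C^3(D, R), in the sense of three times differentiable functions:
   continuity of the third derivative is not required. *)
Definition three_times_differentiable_on (R : realType) (D : set R)
    (g : R -> R) : Prop :=
  forall k, (k < 3)%N -> differentiable_on D (derive_on_n D k g).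

Definition frac_part (R : realType) (x : R) : R := x - (Num.floor x)%:~R.

(* Sequences are indexed from 1; the term of index 0 is ignored. *)
Definition uniformly_distributed_mod1 (R : realType) (x : nat -> R) : Prop :=
  forall u v : R, 0 <= u -> u < v -> v <= 1 ->
    (count (fun n => u <= frac_part (x n) <= v) (index_iota 1 N.+1))%:R / N%:R
      @[N --> \oo] --> v - u.

(* Main.v *)
Require Import Defs.
From HB Require Import structures.
From mathcomp Require Import all_boot all_order all_algebra.
From mathcomp Require Import all_classical all_reals all_analysis.
From mathcomp Require Import measurable_realfun.
From mathcomp Require Import ring lra zify.

Set Implicit Arguments.
Unset Strict Implicit.
Unset Printing Implicit Defensive.

Import Order.TTheory GRing.Theory Num.Theory.
Import numFieldNormedType.Exports.

Local Open Scope classical_set_scope.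
Local Open Scope ring_scope.

(** Let e(x) = exp(2 i pi x), let D be the entropy of p divided by - ln |r|, and let [al, be]
    be the convex hull of X.

    By Weyl's criterion ([weyl_criterion]) it suffices that, for each l >= 1 and almost every x,
    the sums S_N(x) of the e(l f_n(x)), n <= N, are o(N). The integral of |S_N| ^ 2 is the sum over
    m, n of the correlations, the integrals of e(l (f_n - f_m)). If these are O(1 / n) for m < n,
    then the second moment is O(N) ([second_moment]); a Borel-Cantelli argument along N = k ^ 2
    and an interpolation between consecutive squares conclude ([equidistribution_ae]).

    The heart of the matter is the decay of the integral of e(g) for a phase g whose first two
    derivatives are at most a large number V, with |g''| at least V ^ (1 - eps)
    ([oscillatory_decay]). Choose k so that |r| ^ (2 k) is slightly less than 1 / V. On a cylinder of
    level k, of size |r| ^ k, the phase is affine up to a small error. Since all maps have the same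
    ratio, a second use of self-similarity turns the integral into a bilinear sum over pairs of
    words (u, v) of length k, with weights p_u p_v and terms e(theta_u + xi_u y_v), where xi_u is
    r ^ k times g' on the cylinder of u and y_v is the position of the cylinder of v. The y_v are
    separated because the cylinders are, and the xi_u are separated because moreover |g''| is bounded
    below. Rounding both families to grids leads to terms e(j_u i_v / N) with N about |r| ^ (- k),
    and Parseval on Z/N bounds the sum by q sqrt N, where q is the largest weight p_u
    ([bilinear_le]). Words that are heavier than typical have exponentially small total weight
    ([atypical_mass]); without them q is about |r| ^ (k D). Thus q ^ 2 N is about
    |r| ^ (k (2 D - 1)), which decays exactly when D > 1/2.

    Two points remain in order to apply this to g = l (f_n - f_m) ([decay_on_word]). The bounds on
    the derivatives compare with x ^ n, which changes exponentially over the hull; therefore the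
    measure is first restricted to cylinders so short that ln x is almost constant there.
    Besides, no upper bound on g'' is assumed: it follows, away from the endpoints of the hull,
    from the bound on g' and the monotonicity of g'' that the sign of g''' provides
    ([second_derivative_bound]). The endpoints themselves are negligible because the measure has no
    atoms ([atomless]). *)

(** * The real and imaginary parts of e(x) = exp(2 i pi x) *)

Section Trig.
Variable R : realType.
Implicit Types x y : R.

(** Frequencies are measured in turns, so that integers are periods of [ecos] and [esin]. *)
Definition ecos x : R := cos (2 * pi * x).
Definition esin x : R := sin (2 * pi * x).

Lemma ecosD x y : ecos (x + y) = ecos x * ecos y - esin x * esin y.
Proof. by rewrite /ecos /esin mulrDr cosD. Qed.

Lemma esinD x y : esin (x + y) = esin x * ecos y + ecos x * esin y.
Proof. by rewrite /ecos /esin mulrDr sinD. Qed.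

Lemma ecosN x : ecos (- x) = ecos x.
Proof. by rewrite /ecos mulrN cosN. Qed.

Lemma esinN x : esin (- x) = - esin x.
Proof. by rewrite /esin mulrN sinN. Qed.

Lemma ecosB x y : ecos (x - y) = ecos x * ecos y + esin x * esin y.
Proof. by rewrite ecosD ecosN esinN mulrN opprK. Qed.

Lemma ecos2Desin2 x : ecos x ^+ 2 + esin x ^+ 2 = 1.
Proof. exact: cos2Dsin2. Qed.

Lemma esin_sq x : esin x ^+ 2 = 1 - ecos x ^+ 2.
Proof. exact: sin2cos2. Qed.

Lemma ecos0 : ecos 0 = 1.
Proof. by rewrite /ecos mulr0 cos0. Qed.

Lemma esin0 : esin 0 = 0.
Proof. by rewrite /esin mulr0 sin0. Qed.

Lemma ecos_le1 x : ecos x <= 1. Proof. exact: cos_le1. Qed.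

Lemma ecos_abs_le1 x : `|ecos x| <= 1. Proof. exact: cos_max. Qed.

Lemma esin_abs_le1 x : `|esin x| <= 1. Proof. exact: sin_max. Qed.

Lemma ecos1 : ecos 1 = 1.
Proof. by rewrite /ecos mulr1 mulr_natl cos2pi. Qed.

Lemma esin1 : esin 1 = 0.
Proof. by rewrite /esin mulr1 mulr_natl sin2pi. Qed.

Lemma ecosDnat x (n : nat) : ecos (x + n%:R) = ecos x /\ esin (x + n%:R) = esin x.
Proof.
elim: n => [|n [IHc IHs]]; first by rewrite addr0.
rewrite -natr1 addrA ecosD (esinD (x + _)) IHc IHs ecos1 esin1.
by rewrite !mulr0 !mulr1 subr0 addr0.
Qed.

Lemma ecosDint x (k : int) : ecos (x + k%:~R) = ecos x.
Proof.
case: k => n; first by case: (ecosDnat x n).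
by have [<- _] := ecosDnat (x + (Negz n)%:~R) n.+1; rewrite NegzE rmorphN /= addrNK.
Qed.

Lemma esinDint x (k : int) : esin (x + k%:~R) = esin x.
Proof.
case: k => n; first by case: (ecosDnat x n).
by have [_ <-] := ecosDnat (x + (Negz n)%:~R) n.+1; rewrite NegzE rmorphN /= addrNK.
Qed.

Lemma ecos_int (k : int) : ecos k%:~R = 1.
Proof. by rewrite -[k%:~R]add0r ecosDint ecos0. Qed.

Lemma ecos_lip x y : `|ecos x - ecos y| <= 2 * pi * `|x - y|.
Proof.
wlog xy : x y / x < y.
  move=> H; have [xy|xy|->] := ltgtP x y; first exact: H.
    by rewrite distrC (distrC x); exact: H.
  by rewrite !subrr normr0 mulr0.
have D (z : R) : is_derive z 1 ecos (- sin (2 * pi * z) * (2 * pi)).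
  have Dl : is_derive z 1 (fun w : R => 2 * pi * w) (2 * pi).
    by apply: is_derive_eq; rewrite /GRing.scale /= mulr1.
  have -> : ecos = cos \o (fun w : R => 2 * pi * w) by [].
  by apply: is_derive_eq; rewrite /GRing.scale /=.
have [|c _] := @MVT R ecos _ x y xy (fun z _ => D z).
  apply: continuous_subspaceT => z; apply: differentiable_continuous.
  by apply/derivable1_diffP; apply: ex_derive; exact: D.
have p0 : 0 <= 2 * pi :> R by rewrite mulr_ge0 ?pi_ge0.
rewrite distrC (distrC x) => ->; rewrite normrM ler_wpM2r ?normr_ge0 //.
by rewrite normrM normrN (ger0_norm p0) ler_piMl // sin_max.
Qed.

(** Quantifies how far e(x) stays from 1 when x stays away from the integers; by symmetry
    it suffices to use the monotonicity of cos on [0, pi]. *)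
Lemma ecos_le_edge d x : 0 <= d -> d <= x -> x <= 1 - d -> ecos x <= ecos d.
Proof.
have p0 : 0 < pi :> R := pi_gt0 R.
wlog x2 : x / x <= 2^-1.
  move=> H d0 dx xd; have [|x2] := leP x 2^-1; first by move=> ?; apply: H.
  have -> : ecos x = ecos (1 - x) by rewrite addrC ecosD ecosN esinN ecos1 esin1; ring.
  by apply: H => //; lra.
move=> d0 dx xd; rewrite /ecos leNgt ltr_cos ?in_itv /= -?leNgt; last 2 first.
- by apply/andP; split; nra.
- by apply/andP; split; nra.
by nra.
Qed.

Lemma ecos_lt1 x : 0 < x -> x < 1 -> ecos x < 1.
Proof.
have p0 : 0 < pi :> R := pi_gt0 R.
move=> x0 x1; pose d := Num.min x (1 - x).
have d0 : 0 < d by rewrite lt_min x0 subr_gt0.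
have dx : d <= x by rewrite ge_min lexx.
have dx' : d <= 1 - x by rewrite ge_min lexx orbT.
apply: (le_lt_trans (@ecos_le_edge d x _ _ _)) => //; try lra.
rewrite -ecos0 /ecos ltr_cos ?in_itv /= ?mulr0 ?lexx ?pi_ge0 //; last by apply/andP; split; nra.
by nra.
Qed.

(** Real and imaginary parts of (e(x) - 1) (1 + e(x) + ... + e((L-1) x)) = e(L x) - 1. *)
Lemma geometric_sum x (L : nat) :
  (\sum_(j < L) ecos (j%:R * x)) * (ecos x - 1)
    - (\sum_(j < L) esin (j%:R * x)) * esin x = ecos (L%:R * x) - 1
  /\ (\sum_(j < L) ecos (j%:R * x)) * esin x
    + (\sum_(j < L) esin (j%:R * x)) * (ecos x - 1) = esin (L%:R * x).
Proof.
elim: L => [|L [IHc IHs]].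
  by rewrite !big_ord0 !mul0r ecos0 esin0 !subrr addr0.
rewrite !big_ord_recr /= -[L.+1%:R]natr1 (mulrDl L%:R 1 x) mul1r ecosD esinD.
move: IHc IHs; set a := ecos (L%:R * x); set b := esin (L%:R * x).
set C := \sum_(_ < _) _; set S := \sum_(_ < _) _ => IHc IHs; split.
  transitivity ((C * (ecos x - 1) - S * esin x) + (a * (ecos x - 1) - b * esin x)).
    by ring.
  by rewrite IHc; ring.
transitivity ((C * esin x + S * (ecos x - 1)) + (a * esin x + b * (ecos x - 1))).
  by ring.
by rewrite IHs; ring.
Qed.

Lemma geometric_sum_sq x (L : nat) :
  ((\sum_(j < L) ecos (j%:R * x)) ^+ 2 + (\sum_(j < L) esin (j%:R * x)) ^+ 2)
    * (2 - 2 * ecos x) = 2 - 2 * ecos (L%:R * x).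
Proof.
have [Hc Hs] := geometric_sum x L.
have H1 := esin_sq x; have H2 := esin_sq (L%:R * x).
have E : (ecos (L%:R * x) - 1) ^+ 2 + esin (L%:R * x) ^+ 2 = 2 - 2 * ecos (L%:R * x).
  by rewrite H2; ring.
rewrite -E -Hc -Hs.
set C := \sum_(_ < _) _; set S := \sum_(_ < _) _.
transitivity ((C ^+ 2 + S ^+ 2) * ((ecos x - 1) ^+ 2 + esin x ^+ 2)); last by ring.
by rewrite H1; ring.
Qed.

Lemma ecos_div_neq1 (N : nat) (d : int) :
  (0 < N)%N -> ~~ (N%:Z %| d)%Z -> ecos (d%:~R / N%:R) != 1.
Proof.
move=> N0 Nd; have NR : 0 < N%:R :> R by rewrite ltr0n.
have -> : d%:~R / N%:R = (d %% N)%Z%:~R / N%:R + (d %/ N)%Z%:~R :> R.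
  rewrite {1}(divz_eq d N) rmorphD rmorphM /= mulrDl mulfK ?gt_eqF //.
  by rewrite addrC.
rewrite ecosDint lt_eqF //; apply: ecos_lt1.
  rewrite divr_gt0 // ltr0z lt_neqAle modz_ge0 ?andbT; last by lia.
  by rewrite eq_sym; apply: contra Nd => /eqP /dvdz_mod0P.
rewrite ltr_pdivrMr // mul1r -[N%:R]/((N%:Z)%:~R) ltr_int.
by apply: ltz_pmod; lia.
Qed.

(** Orthogonality of the characters of Z/N: when N does not divide d the factor e(d/N) - 1 of
    the geometric sum is nonzero whereas e(N d/N) - 1 = 0. *)
Lemma geometric_sum_orth (N : nat) (d : int) : (0 < N)%N ->
  \sum_(j < N) ecos (j%:R * (d%:~R / N%:R)) = (if (N%:Z %| d)%Z then N%:R else 0)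
  /\ \sum_(j < N) esin (j%:R * (d%:~R / N%:R)) = 0.
Proof.
move=> N0; have NR : N%:R != 0 :> R by rewrite pnatr_eq0 -lt0n.
have [/dvdzP[k ->]|Nd] := boolP (N%:Z %| d)%Z.
  have E (j : nat) : j%:R * ((k * N%:Z)%:~R / N%:R) = (j%:Z * k)%:~R :> R.
    by rewrite !rmorphM /= mulfK.
  split; last first.
    by apply: big1 => j _; rewrite E -[_%:~R]add0r esinDint esin0.
  rewrite (eq_bigr (fun=> 1)); last by move=> j _; rewrite E ecos_int.
  by rewrite sumr_const card_ord.
have := geometric_sum_sq (d%:~R / N%:R) N.
rewrite [N%:R * _]mulrC divfK // ecos_int mulr1 subrr => /eqP.
rewrite mulf_eq0 => /orP[|]; last first.
  rewrite subr_eq0 -{1}[2]mulr1 (inj_eq (mulfI _)) // eq_sym.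
  by rewrite (negPf (ecos_div_neq1 N0 Nd)).
rewrite paddr_eq0 ?sqr_ge0 // !sqrf_eq0 => /andP[/eqP -> /eqP ->].
by [].
Qed.

End Trig.

(** * Bilinear exponential sums and Parseval on the integers mod N *)

Section Bilinear.
Variable R : realType.

(** Expansion of a squared modulus; the only place where products of exponentials are
    multiplied out. *)
Lemma sq_expsum (I : Type) (s : seq I) (P : pred I) (a th : I -> R) :
  (\sum_(i <- s | P i) a i * ecos (th i)) ^+ 2
    + (\sum_(i <- s | P i) a i * esin (th i)) ^+ 2
  = \sum_(i <- s | P i) \sum_(j <- s | P j) a i * a j * ecos (th i - th j).
Proof.
rewrite !expr2 !big_distrl /= -big_split /=; apply: eq_bigr => i _.
rewrite !big_distrr /= -big_split /=; apply: eq_bigr => j _.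
by rewrite ecosB; ring.
Qed.

Variables (U : finType) (N : nat).
Hypothesis N0 : (0 < N)%N.

Definition expsum_sq (G : pred U) (p : U -> R) (i : U -> int) (m : int) : R :=
  (\sum_(v | G v) p v * ecos (m%:~R * (i v)%:~R / N%:R)) ^+ 2
  + (\sum_(v | G v) p v * esin (m%:~R * (i v)%:~R / N%:R)) ^+ 2.

(** The frequencies i v are integers over N, hence the sum only sees m modulo N. *)
Lemma expsum_sq_mod G p i m : expsum_sq G p i m = expsum_sq G p i (m %% N)%Z.
Proof.
have NR : N%:R != 0 :> R by rewrite pnatr_eq0 -lt0n.
have E v : m%:~R * (i v)%:~R / N%:R =
    (m %% N)%Z%:~R * (i v)%:~R / N%:R + ((m %/ N)%Z * i v)%:~R :> R.
  rewrite {1}(divz_eq m N) rmorphD !rmorphM /= !mulrDl addrC; congr (_ + _).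
  by rewrite [LHS]mulrAC mulfK.
rewrite /expsum_sq; congr (_ ^+ 2 + _ ^+ 2); apply: eq_bigr => v _; congr (_ * _).
  by rewrite E ecosDint.
by rewrite E esinDint.
Qed.

Lemma expsum_sq_ge0 G p i m : 0 <= expsum_sq G p i m.
Proof. by rewrite addr_ge0 ?sqr_ge0. Qed.

(** Opening the square, the sum over m kills every pair u, v with u <> v, because the i v are
    distinct modulo N. *)
Lemma parseval (G : pred U) (p : U -> R) (i : U -> int) :
  (forall u v, G u -> G v -> (N%:Z %| i u - i v)%Z -> u = v) ->
  \sum_(m < N) expsum_sq G p i m = N%:R * \sum_(v | G v) p v ^+ 2.
Proof.
move=> inj_i; rewrite /expsum_sq.
under eq_bigr do rewrite sq_expsum.
rewrite exchange_big mulr_sumr /=; apply: eq_bigr => u Gu.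
rewrite exchange_big /= (bigD1 u) //= [X in _ + X]big1 => [|v /andP[Gv vu]].
  rewrite addr0 (eq_bigr (fun=> p u ^+ 2)); last first.
    by move=> m _; rewrite subrr ecos0 mulr1.
  by rewrite sumr_const card_ord mulr_natl.
rewrite -mulr_sumr.
under eq_bigr => m _ do rewrite -mulrBl -mulrBr -rmorphB /= -mulrA.
have [-> _] := geometric_sum_orth R (i u - i v) N0.
rewrite ifN ?mulr0 //; apply: contraNN vu => Nd.
by apply/eqP/esym; exact: inj_i Nd.
Qed.

(** The j u occupy distinct classes modulo N, so this is a partial sum of a complete,
    nonnegative sum over Z/N. *)
Lemma sum_expsum_sq_le (G : pred U) (p : U -> R) (i j : U -> int) :
  (forall u v, G u -> G v -> (N%:Z %| i u - i v)%Z -> u = v) ->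
  (forall u v, G u -> G v -> (N%:Z %| j u - j v)%Z -> u = v) ->
  \sum_(u | G u) expsum_sq G p i (j u) <= N%:R * \sum_(v | G v) p v ^+ 2.
Proof.
move=> inj_i inj_j; rewrite -(parseval _ inj_i).
have jP u : (`|(j u %% N)%Z| < N)%N.
  have N1 : (0 < N%:Z)%R by lia.
  by have := ltz_pmod (j u) N1; have := modz_ge0 (j u) (lt0r_neq0 N1); lia.
pose J u := Ordinal (jP u).
have JE u : expsum_sq G p i (j u) = expsum_sq G p i (J u).
  rewrite expsum_sq_mod /=; congr expsum_sq; rewrite gez0_abs // modz_ge0 //; lia.
under eq_bigr do rewrite JE.
have injJ : {in G &, injective J}.
  move=> u v Gu Gv /(congr1 (fun z : 'I_N => (z : nat)%:Z)) /= E.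
  apply: inj_j => //; apply/dvdz_mod0P.
  have N1 : N%:Z != 0 by lia.
  have E2 : (j u %% N)%Z = (j v %% N)%Z.
    by move: E; rewrite !gez0_abs // modz_ge0.
  by rewrite -modzDml E2 modzDml subrr mod0z.
rewrite -(@big_imset _ _ +%R _ _ J G (fun m : 'I_N => expsum_sq G p i m)) //=.
rewrite [leRHS](bigID (mem [set J x | x in G]%SET)) /= lerDl.
by apply: sumr_ge0 => m _; exact: expsum_sq_ge0.
Qed.

(** Cauchy-Schwarz followed by Parseval. The inequality
    |z| <= tau / 2 + z ^ 2 / (2 tau) replaces the square root of Cauchy-Schwarz, and
    each p u is bounded by q when it multiplies a square. Optimizing tau gives q * sqrt N. *)
Lemma bilinear_le (G : pred U) (p th : U -> R) (i j : U -> int) (q tau : R) :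
  (forall u, 0 <= p u) -> \sum_u p u <= 1 -> (forall u, G u -> p u <= q) ->
  0 <= q -> 0 < tau ->
  (forall u v, G u -> G v -> (N%:Z %| i u - i v)%Z -> u = v) ->
  (forall u v, G u -> G v -> (N%:Z %| j u - j v)%Z -> u = v) ->
  `|\sum_(u | G u) \sum_(v | G v)
      p u * p v * ecos (th u + (j u)%:~R * (i v)%:~R / N%:R)|
  <= tau / 2 + q ^+ 2 * N%:R / (2 * tau).
Proof.
move=> p0 p1 pq q0 t0 inj_i inj_j.
have GE1 : \sum_(u | G u) p u <= 1.
  rewrite (le_trans _ p1) // [leRHS](bigID G) /= lerDl.
  by apply: sumr_ge0.
have S2 : \sum_(u | G u) p u ^+ 2 <= q.
  rewrite (@le_trans _ _ (\sum_(u | G u) q * p u)) //.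
    by apply: ler_sum => u Gu; rewrite expr2 ler_wpM2r // pq.
  by rewrite -mulr_sumr ler_piMr.
apply: (@le_trans _ _ (\sum_(u | G u) p u * (tau / 2 + expsum_sq G p i (j u) / (2 * tau)))).
  rewrite (le_trans (ler_norm_sum _ _ _)) //; apply: ler_sum => u Gu.
  under eq_bigr => v _ do rewrite -mulrA ecosD.
  rewrite -mulr_sumr normrM (ger0_norm (p0 u)) ler_wpM2l //.
  have -> : \sum_(v | G v) p v * (ecos (th u) * ecos ((j u)%:~R * (i v)%:~R / N%:R) -
      esin (th u) * esin ((j u)%:~R * (i v)%:~R / N%:R)) =
    ecos (th u) * (\sum_(v | G v) p v * ecos ((j u)%:~R * (i v)%:~R / N%:R)) -
    esin (th u) * (\sum_(v | G v) p v * esin ((j u)%:~R * (i v)%:~R / N%:R)).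
    by rewrite !mulr_sumr -sumrB; apply: eq_bigr => v _; ring.
  rewrite /expsum_sq; set C := \sum_(_ | _) _; set S := \sum_(_ | _) _.
  have := ecos2Desin2 (th u); set c := ecos _; set s := esin _ => cs.
  have T : (c * C - s * S) ^+ 2 <= C ^+ 2 + S ^+ 2.
    have -> : C ^+ 2 + S ^+ 2 = (c * C - s * S) ^+ 2 + (s * C + c * S) ^+ 2.
      transitivity ((c ^+ 2 + s ^+ 2) * (C ^+ 2 + S ^+ 2)); first by rewrite cs mul1r.
      by ring.
    by rewrite lerDl sqr_ge0.
  move: T; set z := c * C - s * S; set W := _ + _ => T.
  have -> : tau / 2 + W / (2 * tau) = (tau ^+ 2 + W) / (2 * tau).
    by field; rewrite gt_eqF.
  rewrite ler_pdivlMr ?mulr_gt0 //.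
  have := sqr_ge0 (`|z| - tau); rewrite sqrrB real_normK ?num_real //.
  by lra.
rewrite (@le_trans _ _ (\sum_(u | G u) (p u * (tau / 2) + q * (expsum_sq G p i (j u) / (2 * tau))))) //.
  apply: ler_sum => u Gu; rewrite mulrDr lerD2l ler_wpM2r ?pq //.
  by rewrite divr_ge0 ?expsum_sq_ge0 ?mulr_ge0 // ltW.
rewrite big_split /= -mulr_suml; apply: lerD.
  by rewrite ler_piMl // divr_ge0 // ltW.
rewrite -mulr_sumr -mulr_suml mulrA ler_wpM2r ?invr_ge0 ?mulr_ge0 ?(ltW t0) //.
rewrite expr2 -mulrA ler_wpM2l // (le_trans (sum_expsum_sq_le p inj_i inj_j)) //.
by rewrite mulrC ler_wpM2r.
Qed.

End Bilinear.

(** * Weyl's criterion, by discrete convolution with Fejer kernels *)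

Section Weyl.
Variable R : realType.
Implicit Types x y z : R.

Definition fejer (L : nat) x : R :=
  L%:R^-1 * ((\sum_(j < L) ecos (j%:R * x)) ^+ 2 + (\sum_(j < L) esin (j%:R * x)) ^+ 2).

Lemma fejer_ge0 L x : 0 <= fejer L x.
Proof. by rewrite mulr_ge0 ?invr_ge0 // addr_ge0 ?sqr_ge0. Qed.

Lemma fejerE L x :
  fejer L x = L%:R^-1 * \sum_(i < L) \sum_(j < L) ecos ((i%:Z - j%:Z)%:~R * x).
Proof.
rewrite /fejer; congr (_ * _).
have := @sq_expsum R _ (index_enum 'I_L) xpredT (fun=> 1) (fun j : 'I_L => j%:R * x).
under eq_bigr do rewrite mul1r; under [in X in _ + X ^+ 2]eq_bigr do rewrite mul1r.
move=> ->; apply: eq_bigr => i _; apply: eq_bigr => j _.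
by rewrite !mul1r -mulrBl rmorphB.
Qed.

Lemma fejerDint L x (k : int) : fejer L (x + k%:~R) = fejer L x.
Proof.
rewrite /fejer; congr (_ * (_ ^+ 2 + _ ^+ 2)); apply: eq_bigr => j _.
  by rewrite mulrDr -[(j%:R : R) * k%:~R](rmorphM (intmul 1) j%:Z k) ecosDint.
by rewrite mulrDr -[(j%:R : R) * k%:~R](rmorphM (intmul 1) j%:Z k) esinDint.
Qed.

(** The closed form |e(L x) - 1| ^ 2 / |e(x) - 1| ^ 2 of the squared geometric sum has a
    numerator at most 4. *)
Lemma fejer_le L d x : 0 < d < 1 -> d <= `|x| <= 1 - d ->
  fejer L x <= 2 / (L%:R * (1 - ecos d)).
Proof.
move=> /andP[d0 d1] /andP[dx xd].
have [->|L0] := posnP L; first by rewrite /fejer !mul0r invr0 !mul0r mulr0.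
have k1 : ecos d < 1 by apply: ecos_lt1.
have xk : ecos x <= ecos d.
  have -> : ecos x = ecos `|x| by case: (ger0P x) => // _; rewrite ecosN.
  by apply: ecos_le_edge => //; exact: ltW.
have LR : 0 < L%:R :> R by rewrite ltr0n.
rewrite /fejer invfM mulrA [2 / _]mulrC -mulrA ler_wpM2l ?invr_ge0 ?(ltW LR) //.
rewrite ler_pdivlMr ?subr_gt0 //.
have := geometric_sum_sq x L; set W := _ ^+ 2 + _ ^+ 2 => E.
have W0 : 0 <= W by rewrite addr_ge0 ?sqr_ge0.
have Hc : -1 <= ecos (L%:R * x) by exact: cos_geN1.
by nra.
Qed.

(** Averaging over the grid of mesh 1/L annihilates all frequencies i - j strictly between
    - L and L except 0: the translates of the kernel form a partition of unity. *)
Lemma fejer_sum L x : (0 < L)%N -> \sum_(s < L) fejer L (x - s%:R / L%:R) = L%:R.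
Proof.
move=> L0; have LR : L%:R != 0 :> R by rewrite pnatr_eq0 -lt0n.
under eq_bigr do rewrite fejerE.
rewrite -mulr_sumr exchange_big /=.
rewrite (eq_bigr (fun i : 'I_L => L%:R)); last first.
  move=> i _; rewrite exchange_big /= (bigD1 i) //= [X in _ + X]big1.
    rewrite addr0 (eq_bigr (fun=> 1)); first by rewrite sumr_const card_ord.
    by move=> s _; rewrite subrr mul0r ecos0.
  move=> j ji; set d : int := i%:Z - j%:Z.
  under eq_bigr => s _.
    rewrite mulrBr [_ * (s%:R / _)]mulrCA ecosB. over.
  rewrite big_split /= -!mulr_sumr.
  have [-> ->] := geometric_sum_orth R d L0.
  rewrite mulr0 addr0 ifN ?mulr0 //.
  apply/negP => /dvdzP[q qE].
  have : (`|d| < L)%N.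
    by rewrite /d; have := ltn_ord i; have := ltn_ord j; lia.
  rewrite qE abszM absz_nat; case: (altP (q =P 0)) => [q0|q0]; last by nia.
  move: ji; rewrite -val_eqE /=; move: qE; rewrite q0 mul0r /d; lia.
by rewrite sumr_const card_ord -[X in _ * X]mulr_natr mulKf.
Qed.

Variable x : nat -> R.
Hypothesis weyl_cos : forall l : nat, (0 < l)%N ->
  (\sum_(1 <= n < N.+1) ecos (l%:R * x n)) / N%:R @[N --> \oo] --> 0.
Hypothesis weyl_sin : forall l : nat, (0 < l)%N ->
  (\sum_(1 <= n < N.+1) esin (l%:R * x n)) / N%:R @[N --> \oo] --> 0.

(** The hypotheses only concern positive frequencies; negative ones follow by conjugation. *)
Lemma weyl_shift (d : int) y :
  (\sum_(1 <= n < N.+1) ecos (d%:~R * (x n - y))) / N%:R @[N --> \oo] --> ((d == 0)%:R : R).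
Proof.
have [->|d0] /= := eqVneq d 0.
  apply: cvg_near_cst; near=> N.
  have N0 : (0 < N)%N by near: N; exists 1%N.
  rewrite (eq_bigr (fun=> 1)) => [|n _]; last by rewrite mul0r ecos0.
  by rewrite sumr_const_nat subn1 /= divff // pnatr_eq0 -lt0n.
have E : (fun N : nat => (\sum_(1 <= n < N.+1) ecos (d%:~R * (x n - y))) / N%:R)
  = (fun N : nat => ecos (d%:~R * y) * ((\sum_(1 <= n < N.+1) ecos (`|d|%N%:R * x n)) / N%:R)
      + Num.sg d%:~R * esin (d%:~R * y) * ((\sum_(1 <= n < N.+1) esin (`|d|%N%:R * x n)) / N%:R)).
  apply/funext => N; rewrite !mulrA -mulrDl; congr (_ / _).
  rewrite !mulr_sumr -big_split /=; apply: eq_bigr => n _.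
  have -> : (`|d|%N%:R : R) = `|d|%:~R by rewrite natr_absz.
  rewrite mulrBr ecosB.
  have [dp|dn|dz] := ltgtP d 0.
  - rewrite ltr0_norm // ltr0_sg ?ltrz0 // rmorphN /= mulNr ecosN esinN.
    by ring.
  - by rewrite gtr0_norm // gtr0_sg ?ltr0z //; ring.
  by rewrite dz eqxx in d0.
rewrite E.
have [cc cs] : (\sum_(1 <= n < N.+1) ecos (`|d|%N%:R * x n)) / N%:R @[N --> \oo] --> (0 : R)
  /\ (\sum_(1 <= n < N.+1) esin (`|d|%N%:R * x n)) / N%:R @[N --> \oo] --> (0 : R).
  by split; [apply: weyl_cos|apply: weyl_sin]; rewrite absz_gt0.
have := cvgD (cvgMl_tmp (a := ecos (d%:~R * y)) cc) (cvgMl_tmp (a := Num.sg d%:~R * esin (d%:~R * y)) cs).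
by rewrite !mulr0 addr0; exact.
Unshelve. all: by end_near. Qed.

Lemma fejer_avg L y : (0 < L)%N ->
  (\sum_(1 <= n < N.+1) fejer L (x n - y)) / N%:R @[N --> \oo] --> (1 : R).
Proof.
move=> L0; have LR : L%:R != 0 :> R by rewrite pnatr_eq0 -lt0n.
have E : (fun N : nat => (\sum_(1 <= n < N.+1) fejer L (x n - y)) / N%:R)
  = (fun N : nat => L%:R^-1 * \sum_(i < L) \sum_(j < L)
     (\sum_(1 <= n < N.+1) ecos ((i%:Z - j%:Z)%:~R * (x n - y))) / N%:R).
  apply/funext => N; under eq_bigr do rewrite fejerE.
  rewrite -mulr_sumr -mulrA; congr (_ * _).
  rewrite exchange_big mulr_suml /=; apply: eq_bigr => i _.
  by rewrite exchange_big mulr_suml /=.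
rewrite E.
have e1 : L%:R^-1 * \sum_(i < L) \sum_(j < L) ((i%:Z - j%:Z) == 0)%:R = 1 :> R.
  rewrite (eq_bigr (fun=> 1)); first by rewrite sumr_const card_ord mulVf.
  move=> i _; rewrite (bigD1 i) //= subrr eqxx big1 ?addr0 // => j ji.
  rewrite subr_eq0; case: eqP => // -[] /val_inj ij; by rewrite ij eqxx in ji.
rewrite -[X in _ --> X]e1; apply: cvgMl_tmp.
apply: cvg_big => [|i _]; [exact: add_continuous|].
apply: cvg_big => [|j _]; [exact: add_continuous|].
exact: weyl_shift.
Qed.

Definition hits (u v : R) (N : nat) : R :=
  (count (fun n => u <= frac_part (x n) <= v) (index_iota 1 N.+1))%:R.

Lemma hits_ge0 u v N : 0 <= hits u v N.
Proof. exact: ler0n. Qed.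

Lemma frac_part_itv z : 0 <= frac_part z < 1.
Proof.
rewrite /frac_part; have := floor_itv z.
by rewrite rmorphD /= => /andP[a b]; rewrite subr_ge0 a ltrBlDl.
Qed.

(** The sum A of the Fejer kernels centred at the grid points well inside [u, v] is at most 1
    everywhere and small outside [u, v], so it is a smooth minorant of the indicator of [u, v]
    up to e/4. Its average along the sequence converges to the proportion of grid points used. *)
Lemma hits_lower u v e : 0 <= u -> u < v -> v <= 1 -> 0 < e ->
  \forall N \near \oo, v - u - e <= hits u v N / N%:R.
Proof.
move=> u0 uv v1 e0.
pose d : R := Num.min (e / 8) 4^-1.
have d0 : 0 < d by rewrite lt_min divr_gt0 ?invr_gt0 /=.
have de : d <= e / 8 by rewrite ge_min lexx.
have d4 : d <= 4^-1 by rewrite ge_min lexx orbT.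
have k1 : ecos d < 1 by apply: ecos_lt1 => //; lra.
(* L makes both the mesh 1/L and the tail 2 / (L (1 - ecos d)) of the kernel small *)
pose L := (Num.trunc (8 / e + 8 / (e * (1 - ecos d)))).+1.
have LR : 8 / e + 8 / (e * (1 - ecos d)) < L%:R by rewrite truncnS_gt.
have e1 : 0 < e * (1 - ecos d) by rewrite mulr_gt0 // subr_gt0.
have L1 : 8 / e <= L%:R by rewrite (le_trans _ (ltW LR)) // lerDl divr_ge0 // ltW.
have L2 : 8 / (e * (1 - ecos d)) <= L%:R.
  by rewrite (le_trans _ (ltW LR)) // lerDr divr_ge0 // ltW.
have L0 : (0 < L)%N by [].
have LR0 : 0 < L%:R :> R by rewrite ltr0n.
pose s0 := (Num.trunc (L%:R * (u + d))).+1.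
pose s1 := (Num.trunc (L%:R * (v - d))).+1.
pose A (n : nat) : R := L%:R^-1 * \sum_(s0 <= s < s1) fejer L (x n - s%:R / L%:R).
have s1L : (s1 <= L)%N.
  rewrite /s1 /L ltnS truncn_le_nat -/L -[ltRHS]mulr1 ltr_pM2l //; lra.
have Abd n : A n <= (u <= frac_part (x n) <= v)%R%:R + e / 4.
  have Asum : A n <= 1.
    rewrite /A ler_pdivrMl // mulr1 -[leRHS](fejer_sum (x n) L0)
      -(big_mkord xpredT (fun s => fejer L (x n - s%:R / L%:R))).
    have [s01|s01] := leqP s0 s1; last first.
      by rewrite [leLHS]big_geq ?(ltnW s01) //; apply: sumr_ge0 => s _; exact: fejer_ge0.
    rewrite [leRHS](big_cat_nat _ (n := s0)) //= ?(leq_trans s01) //.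
    rewrite [X in _ <= _ + X](big_cat_nat _ (n := s1)) //= addrCA lerDl addr_ge0 //;
      by apply: sumr_ge0 => s _; exact: fejer_ge0.
  have [_|nI] := boolP (u <= frac_part (x n) <= v).
    by rewrite (le_trans Asum) // lerDl divr_ge0 // ltW.
  rewrite add0r /A.
  have /andP[f0 f1] := frac_part_itv (x n).
  have B s : (s0 <= s < s1)%N -> fejer L (x n - s%:R / L%:R) <= e / 4.
    move=> /andP[ss0 ss1].
    have Ls0 : u + d <= s%:R / L%:R.
      rewrite ler_pdivlMr // mulrC (le_trans (ltW (truncnS_gt _))) //.
      by rewrite ler_nat.
    have Ls1 : s%:R / L%:R <= v - d.
      rewrite ler_pdivrMr // mulrC.
      have vd : 0 <= L%:R * (v - d).
        rewrite leNgt; apply/negP => vd; have : (s <= 0)%N.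
          by rewrite -ltnS (leq_trans ss1) // ltnS truncn_le_nat (lt_trans vd).
        by rewrite leqNgt (leq_trans _ ss0).
      by rewrite (@le_trans _ _ (Num.trunc (L%:R * (v - d)))%:R) ?truncn_le // ler_nat -ltnS.
    have -> : x n - s%:R / L%:R = frac_part (x n) - s%:R / L%:R + (Num.floor (x n))%:~R.
      by rewrite /frac_part; ring.
    rewrite fejerDint (le_trans (@fejer_le L d _ _ _)) //; first by apply/andP; split; lra.
      move: nI; rewrite negb_and -!ltNge => /orP[H|H].
        rewrite ltr0_norm; last by lra.
        by apply/andP; split; lra.
      rewrite gtr0_norm; last by lra.
      by apply/andP; split; lra.
    rewrite ler_pdivrMr ?mulr_gt0 ?subr_gt0 //.
    move: L2; rewrite ler_pdivrMr //; lra.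
  rewrite ler_pdivrMl // (@le_trans _ _ (\sum_(s0 <= s < s1) e / 4)) //.
    by apply: ler_sum_nat.
  rewrite sumr_const_nat -[leLHS]mulr_natl ler_wpM2r ?divr_ge0 ?(ltW e0) // ler_nat.
  by rewrite (leq_trans (leq_subr _ _)).
have cA : (\sum_(1 <= n < N.+1) A n) / N%:R @[N --> \oo] --> (L%:R^-1 * (s1 - s0)%N%:R : R).
  have E : (fun N : nat => (\sum_(1 <= n < N.+1) A n) / N%:R) =
    (fun N : nat => L%:R^-1 * \sum_(s0 <= s < s1)
       (\sum_(1 <= n < N.+1) fejer L (x n - s%:R / L%:R)) / N%:R).
    apply/funext => N; rewrite /A -mulr_sumr -mulrA; congr (_ * _).
    by rewrite exchange_big mulr_suml.
  rewrite E; apply: cvgMl_tmp.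
  rewrite -[X in _ --> X](_ : \sum_(s0 <= s < s1) 1 = _); last by rewrite sumr_const_nat.
  by apply: cvg_big => [|s _]; [exact: add_continuous|exact: fejer_avg].
have s10 : v - u - 2 * d - L%:R^-1 <= L%:R^-1 * (s1 - s0)%N%:R.
  have T1 : L%:R * (v - d) < s1%:R by rewrite truncnS_gt.
  have T0 : s0%:R <= L%:R * (u + d) + 1.
    rewrite -natr1 lerD2r truncn_le // mulr_ge0 ?(ltW LR0) //; lra.
  rewrite ler_pdivlMl // mulrDr mulrN divff ?gt_eqF //.
  have : s1%:R - s0%:R <= (s1 - s0)%N%:R :> R.
    have [s01|s01] := leqP s0 s1; first by rewrite natrB.
    by rewrite (@le_trans _ _ 0) // subr_le0 ler_nat ltnW.
  by nra.
have Linv : L%:R^-1 <= e / 8.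
  rewrite -[L%:R^-1]mul1r ler_pdivrMr //; move: L1; rewrite ler_pdivrMr //; lra.
have lt1 : v - u - e / 2 < L%:R^-1 * (s1 - s0)%N%:R by lra.
near=> N.
have N0 : (0 < N)%N by near: N; exists 1%N.
have NR : 0 < N%:R :> R by rewrite ltr0n.
have c1 : v - u - e / 2 <= (\sum_(1 <= n < N.+1) A n) / N%:R.
  by near: N; exact: (cvgr_ge _ cA).
have c2 : (\sum_(1 <= n < N.+1) A n) / N%:R <= hits u v N / N%:R + e / 4.
  rewrite ler_pdivrMr // mulrDl divfK ?gt_eqF //.
  rewrite /hits -sum1_count natr_sum [X in _ <= X + _]big_mkcond /=.
  rewrite (@le_trans _ _ (\sum_(1 <= n < N.+1) ((u <= frac_part (x n) <= v)%R%:R + e / 4))) //.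
    by apply: ler_sum_nat => n _.
  rewrite big_split /= sumr_const_nat subn1 /= mulr_natr lerD2r.
  by apply: ler_sum_nat => n _; case: ifP.
by lra.
Unshelve. all: by end_near. Qed.

(** Lower bounds suffice: the upper bound for [u, v] comes from the lower bounds for the two
    intervals that remain on either side of [u, v]. *)
Lemma weyl_criterion : uniformly_distributed_mod1 x.
Proof.
move=> u v u0 uv v1.
have -> : (fun N => (count (fun n => u <= frac_part (x n) <= v) (index_iota 1 N.+1))%:R / N%:R)
  = (fun N => hits u v N / N%:R) by [].
apply/cvgrPdist_le => e e0.
pose d := e / 8.
have d0 : 0 < d by rewrite divr_gt0.
have Hl : \forall N \near \oo, u - 2 * d <= hits 0 (u - d) N / N%:R.
  have [ud|ud] := leP (u - d) 0.
    by apply: nearW => N; rewrite (@le_trans _ _ 0) ?divr_ge0 ?hits_ge0 //; lra.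
  have -> : u - 2 * d = (u - d) - 0 - d by ring.
  by apply: hits_lower => //; lra.
have Hr : \forall N \near \oo, 1 - v - 2 * d <= hits (v + d) 1 N / N%:R.
  have [vd|vd] := leP 1 (v + d).
    by apply: nearW => N; rewrite (@le_trans _ _ 0) ?divr_ge0 ?hits_ge0 //; lra.
  have -> : 1 - v - 2 * d = 1 - (v + d) - d by ring.
  by apply: hits_lower => //; lra.
near=> N.
have N0 : (0 < N)%N by near: N; exists 1%N.
have NR : 0 < N%:R :> R by rewrite ltr0n.
have lo : v - u - e <= hits u v N / N%:R by near: N; exact: hits_lower.
have hl : u - 2 * d <= hits 0 (u - d) N / N%:R by near: N.
have hr : 1 - v - 2 * d <= hits (v + d) 1 N / N%:R by near: N.
have tot : hits 0 (u - d) N + hits u v N + hits (v + d) 1 N <= N%:R.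
  rewrite /hits -!natrD ler_nat -!sum1_count !(big_mkcond (fun n => _ <= _ <= _)) /=.
  rewrite -!big_split /= -[leqRHS](subn1 N.+1) -[leqRHS]muln1 -sum_nat_const_nat.
  apply: leq_sum => n _.
  have d1 : u - d < u by rewrite gtrBl.
  have d2 : v < v + d by rewrite ltrDl.
  move: (uv) d1 d2; move: (frac_part (x n)) (u - d) (v + d) => z u' v' uv' d1 d2.
  have [zu|zu] := ltP z u.
    rewrite (lt_geF (lt_trans zu (lt_trans uv' d2))) /= !addn0.
    by case: (0 <= z); case: (z <= u').
  rewrite (lt_geF (lt_le_trans d1 zu)) andbF /=.
  have [zv|zv] := leP z v; last by case: (v' <= z); case: (z <= 1).
  by rewrite (lt_geF (le_lt_trans zv d2)).
rewrite ler_norml; apply/andP; split; last by lra.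
have : hits u v N / N%:R <= 1 - (u - 2 * d) - (1 - v - 2 * d).
  have -> : hits u v N / N%:R = (hits 0 (u - d) N + hits u v N + hits (v + d) 1 N) / N%:R
    - hits 0 (u - d) N / N%:R - hits (v + d) 1 N / N%:R.
    by field; rewrite gt_eqF.
  have : (hits 0 (u - d) N + hits u v N + hits (v + d) 1 N) / N%:R <= 1.
    by rewrite ler_pdivrMr // mul1r.
  by lra.
by rewrite /d; lra.
Unshelve. all: by end_near. Qed.

End Weyl.

(** * Words, their weights and the cylinders of the iterated function system *)

Section Words.
Variables (R : realType) (A : finType).
Implicit Types (p f g : A -> R) (k : nat).

(** Words of length k form a nested product of copies of A, so that sums over words unfold
    letter by letter. *)
Fixpoint word k : finType :=
  if k is k'.+1 then ((A * word k')%type : finType) else (unit : finType).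

Fixpoint wprod f k : word k -> R :=
  match k with
  | 0 => fun=> 1
  | k'.+1 => fun u => f u.1 * wprod f u.2
  end.

Lemma sum_word k (F : word k.+1 -> R) :
  \sum_u F u = \sum_i \sum_v F (i, v).
Proof. by rewrite pair_bigA /=; apply: eq_bigr => -[]. Qed.

Lemma sum_wprod f k : \sum_(u : word k) wprod f u = (\sum_i f i) ^+ k.
Proof.
elim: k => [|k IH]; first by rewrite /= (big_pred1 tt) // => -[].
rewrite sum_word exprS big_distrl /=; apply: eq_bigr => i _.
by rewrite -IH mulr_sumr.
Qed.

Lemma wprod_ge0 f k (u : word k) : (forall i, 0 <= f i) -> 0 <= wprod f u.
Proof. by move=> f0; elim: k u => [|k IH] u //=; rewrite mulr_ge0. Qed.

Lemma wprodM f g k (u : word k) :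
  wprod (fun i => f i * g i) u = wprod f u * wprod g u.
Proof.
elim: k u => [|k IH] u /=; first by rewrite mulr1.
by rewrite IH mulrACA.
Qed.

Lemma wprod_powR p s k (u : word k) : (forall i, 0 <= p i) ->
  wprod p u `^ s = wprod (fun i => p i `^ s) u.
Proof.
move=> p0; elim: k u => [|k IH] u /=; first by rewrite powR1.
by rewrite powRM ?wprod_ge0 // IH.
Qed.

(** From exp(-x) >= 1 - x and (1 - x) (1 + x + x ^ 2) = 1 - x ^ 3 >= 1. *)
Lemma expR_le_quad (x : R) : x <= 0 -> expR x <= 1 + x + x ^+ 2.
Proof.
move=> x0; have E : expR (- x) * expR x = 1 by rewrite -expRD addNr expR0.
have H : 1 - x <= expR (- x) := expR_ge1Dx (- x).
have P := expR_gt0 x.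
have := ler_wpM2r (ltW P) H; rewrite E => H2.
by nra.
Qed.

Variable p : A -> R.
Hypothesis hp : probability_vector p.

Lemma pv_ge0 i : 0 <= p i. Proof. by case: hp. Qed.

Lemma pv_sum : \sum_i p i = 1. Proof. by case: hp. Qed.

Lemma pv_le1 i : p i <= 1.
Proof.
by rewrite -pv_sum (bigD1 i) //= lerDl sumr_ge0 // => j _; exact: pv_ge0.
Qed.

Lemma sum_pw k : \sum_(u : word k) wprod p u = 1.
Proof. by rewrite sum_wprod pv_sum expr1n. Qed.

(** Second order expansion of the moment generating function of ln p at s = 0, whose
    first derivative there is minus the entropy. *)
Lemma sum_tilted_le s : 0 <= s ->
  \sum_i p i * p i `^ s
    <= expR (- (s * entropy p) + s ^+ 2 * \sum_i p i * ln (p i) ^+ 2).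
Proof.
move=> s0; apply: le_trans (expR_ge1Dx _).
rewrite /entropy mulrN opprK -pv_sum !mulr_sumr -!big_split /=.
apply: ler_sum => i _; have := pv_ge0 i; rewrite le_eqVlt => /predU1P[<-|pi0].
  by rewrite !mul0r !mulr0 !addr0.
have l0 : s * ln (p i) <= 0 by rewrite mulr_ge0_le0 // ln_le0 // pv_le1.
rewrite /powR gt_eqF //.
have := ler_wpM2l (ltW pi0) (expR_le_quad l0).
by rewrite exprMn; lra.
Qed.

(** Chernoff bound: by Markov's inequality applied to the s-th power of the weight, which is
    multiplicative in the letters, the mass of the words heavier than exp(- k (h - e)) is at
    most the k-th power of a number that is smaller than 1 once s is small. *)
Lemma atypical_mass e : 0 < e -> exists2 c : R, 0 < c & forall k,
  \sum_(u : word k | expR (- (k%:R * (entropy p - e))) < wprod p u) wprod p u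
    <= expR (- (c * k%:R)).
Proof.
move=> e0; set h := entropy p.
pose V := \sum_i p i * ln (p i) ^+ 2.
have V0 : 0 <= V.
  by apply: sumr_ge0 => i _; rewrite mulr_ge0 ?sqr_ge0 ?pv_ge0.
(* with this tilt the quadratic term s ^ 2 V is at most half of the linear gain s e *)
pose s := e / (2 * (V + 1)).
have s0 : 0 < s by rewrite divr_gt0 // mulr_gt0 // ltr_wpDl.
have sV : s * V <= e / 2.
  rewrite /s mulrAC ler_pdivrMr ?mulr_gt0 // ?ltr_wpDl //.
  by nra.
exists (s * e / 2); first by rewrite divr_gt0 // mulr_gt0.
move=> k; set q := expR _.
pose Z := expR (s * (k%:R * (h - e))).
apply: (@le_trans _ _ (\sum_(u : word k) wprod p u * wprod p u `^ s * Z)).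
  rewrite [leRHS](bigID (fun u => q < wprod p u)) /=.
  rewrite -[leLHS]addr0; apply: lerD; last first.
    apply: sumr_ge0 => u _; rewrite !mulr_ge0 ?expR_ge0 ?powR_ge0 //.
    by apply: wprod_ge0; exact: pv_ge0.
  apply: ler_sum => u qu.
  have w0 : 0 < wprod p u by rewrite (lt_trans _ qu) // expR_gt0.
  rewrite -mulrA ler_peMr ?(ltW w0) // /powR gt_eqF // /Z -expRD.
  rewrite -[leLHS]expR0 ler_expR.
  have : - (k%:R * (h - e)) <= ln (wprod p u).
    by rewrite -[leLHS]expRK ler_ln ?posrE ?expR_gt0 // ltW.
  by nra.
rewrite -mulr_suml.
under eq_bigr => u _ do rewrite (wprod_powR _ _ pv_ge0) -wprodM.
rewrite sum_wprod.
apply: (@le_trans _ _ (expR (- (s * h) + s ^+ 2 * V) ^+ k * Z)).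
  rewrite ler_wpM2r ?expR_ge0 // lerXn2r ?nnegrE ?expR_ge0 ?sum_tilted_le ?(ltW s0) //.
  by apply: sumr_ge0 => i _; rewrite mulr_ge0 ?powR_ge0 ?pv_ge0.
rewrite -expRM_natl /Z -expRD ler_expR.
have k0 : 0 <= k%:R :> R by [].
have : s ^+ 2 * V <= s * (e / 2) by rewrite expr2 -mulrA ler_wpM2l // ltW.
move=> H.
have -> : k%:R * (- (s * h) + s ^+ 2 * V) + s * (k%:R * (h - e))
  = k%:R * (s ^+ 2 * V - s * e) by ring.
by nra.
Qed.

(** A probability vector with an entry equal to 1 has entropy zero. *)
Lemma pv_lt1 : 0 < entropy p -> forall i, p i < 1.
Proof.
move=> h0 i; rewrite lt_neqAle pv_le1 andbT; apply/eqP => pi1.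
move: h0; rewrite /entropy big1 ?oppr0 ?ltxx // => j _.
have [->|ji] := eqVneq j i; first by rewrite pi1 ln1 mulr0.
suff -> : p j = 0 by rewrite mul0r.
apply/eqP; rewrite eq_le pv_ge0 andbT.
have := pv_sum; rewrite (bigD1 i) //= pi1 (bigD1 j) //=.
have : 0 <= \sum_(l | (l != i) && (l != j)) p l.
  by apply: sumr_ge0 => l _; exact: pv_ge0.
by lra.
Qed.

End Words.

Section Cylinders.
Variables (R : realType) (A : finType) (r : R) (t : A -> R).

(** The map of a word u of length k is y |-> r ^ k y + tau u: with a common ratio, words of the
    same length differ only by a translation. *)
Fixpoint tau k : word A k -> R :=
  match k with
  | 0 => fun=> 0
  | k'.+1 => fun u => r * tau u.2 + t u.1
  end.

Definition word_map k (u : word A k) (y : R) : R := r ^+ k * y + tau u.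

Lemma word_mapS k (u : word A k.+1) y : word_map u y = r * word_map u.2 y + t u.1.
Proof. by rewrite /word_map /= exprS; ring. Qed.

Lemma word_mapB k (u : word A k) y z : word_map u y - word_map u z = r ^+ k * (y - z).
Proof. by rewrite /word_map; ring. Qed.

(** The transfer operator: integrating [average p k F] against the self-similar measure
    is the same as integrating F. *)
Definition average (p : A -> R) k (F : R -> R) (y : R) : R :=
  \sum_(u : word A k) wprod p u * F (word_map u y).

Variables (al be d0 : R).
Hypothesis r1 : `|r| < 1.
Hypothesis phiH : forall i y, al <= y <= be -> al <= r * y + t i <= be.
Hypothesis d0_gt0 : 0 < d0.
Hypothesis gap : forall i j, i != j -> `|r| * (be - al) + d0 <= `|t i - t j|.

Lemma word_map_in k (u : word A k) y : al <= y <= be -> al <= word_map u y <= be.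
Proof.
move=> yH; elim: k u => [|k IH] u; first by rewrite /word_map /= expr0 mul1r addr0.
by rewrite word_mapS; apply: phiH; exact: IH.
Qed.

Lemma letter_sep (i j : A) x y : al <= x <= be -> al <= y <= be -> i != j ->
  d0 <= `|(r * x + t i) - (r * y + t j)|.
Proof.
move=> xH yH /gap ij; have -> : (r * x + t i) - (r * y + t j) = (t i - t j) - r * (y - x) by ring.
have B : `|r * (y - x)| <= `|r| * (be - al).
  by rewrite normrM ler_wpM2l // ler_norml; apply/andP; split; lra.
have := lerB_dist (t i - t j) (r * (y - x)).
by lra.
Qed.

(** At the first letter where two words differ the separation is at least d0, and the common
    prefix of length at most k contracts it by at most |r| ^ k. *)
Lemma word_map_sep k (u v : word A k) y : al <= y <= be -> u != v ->
  `|r| ^+ k * d0 <= `|word_map u y - word_map v y|.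
Proof.
move=> yH; elim: k u v => [|k IH] u v; first by case: u; case: v.
case: u => i u; case: v => j v; rewrite !word_mapS /= => uv.
have [ij|ij] := eqVneq i j; last first.
  apply: (le_trans _ (letter_sep _ _ ij)); try exact: word_map_in.
  by rewrite ler_piMl ?(ltW d0_gt0) // exprn_ile1 // ltW.
subst j.
have -> : r * word_map u y + t i - (r * word_map v y + t i) = r * (word_map u y - word_map v y) by ring.
rewrite normrM exprS -mulrA ler_wpM2l //; apply: IH.
by apply: contra_neq uv => ->.
Qed.

End Cylinders.

(** * Linearization on cylinders and the resulting bilinear bound *)

Section Core.
Variables (R : realType) (A : finType) (r : R) (t : A -> R) (p : A -> R).
Variables (al be d0 : R).
Hypothesis r0 : 0 < `|r|.
Hypothesis r1 : `|r| < 1.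
Hypothesis ab : al <= be.
Hypothesis phiH : forall i y, al <= y <= be -> al <= r * y + t i <= be.
Hypothesis d0_gt0 : 0 < d0.
Hypothesis gap : forall i j, i != j -> `|r| * (be - al) + d0 <= `|t i - t j|.
Hypothesis hp : probability_vector p.

Lemma mvt_itv (f f' : R -> R) :
  (forall y, al <= y <= be -> is_derive y 1 f (f' y)) ->
  forall x y, al <= x <= be -> al <= y <= be ->
  exists c, [/\ al <= c <= be, `|c - x| <= `|y - x| & f y - f x = f' c * (y - x)].
Proof.
move=> D.
have C a b : al <= a -> b <= be -> {within `[a, b], continuous f}.
  move=> aa bb; apply: derivable_within_continuous => z; rewrite in_itv /= => /andP[z1 z2].
  apply: ex_derive; apply: D; apply/andP; split; lra.
have H a b : al <= a -> a <= b -> b <= be ->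
    exists c, [/\ a <= c, c <= b & f b - f a = f' c * (b - a)].
  move=> aa aleb bb; have [|c] := @MVT_segment R f f' a b aleb _ (C _ _ aa bb).
    move=> z; rewrite in_itv /= => /andP[z1 z2]; apply: D; apply/andP; split; lra.
  by rewrite in_itv /= => /andP[c1 c2] E; exists c.
move=> x y /andP[x1 x2] /andP[y1 y2]; have [xy|yx] := leP x y.
  have [c [c1 c2 E]] := H x y x1 xy y2; exists c; split=> //; first by apply/andP; split; lra.
  by rewrite !ger0_norm; lra.
have [c [c1 c2 E]] := H y x y1 (ltW yx) x2; exists c; split; first by apply/andP; split; lra.
  by rewrite !ler0_norm; lra.
by rewrite -[LHS]opprB E; ring.
Qed.

(** Taylor's formula of order two, from two applications of the mean value theorem, since
    nothing is known about the continuity of G2. *)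
Lemma linearization (G0 G1 G2 : R -> R) (M : R) :
  (forall y, al <= y <= be -> is_derive y 1 G0 (G1 y)) ->
  (forall y, al <= y <= be -> is_derive y 1 G1 (G2 y)) ->
  (forall y, al <= y <= be -> `|G2 y| <= M) ->
  forall x y, al <= x <= be -> al <= y <= be ->
  `|G0 y - (G0 x + G1 x * (y - x))| <= M * (y - x) ^+ 2.
Proof.
move=> D0 D1 B x y xH yH.
have [c [cH cx E]] := mvt_itv D0 xH yH.
have [c' [c'H _ E']] := mvt_itv D1 xH cH.
have -> : G0 y - (G0 x + G1 x * (y - x)) = (G1 c - G1 x) * (y - x).
  by rewrite opprD addrA E; ring.
rewrite E' -mulrA normrM; apply: ler_pM => //; first exact: B.
by rewrite normrM -(real_normK (num_real (y - x))) expr2 ler_wpM2r.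
Qed.

(** Lets the rounded frequencies inherit injectivity modulo N from the separation of the real
    numbers that are rounded. *)
Lemma floor_sep (N : nat) (a b : R) : 1 <= `|a - b| -> `|a - b| + 1 < N%:R ->
  (N%:Z %| Num.floor a - Num.floor b)%Z = false.
Proof.
wlog ba : a b / b <= a.
  move=> H; have [|/ltW ab'] := leP b a; first exact: H.
  rewrite distrC => h1 h2; rewrite -(H b a ab' h1 h2) -[in RHS]opprB.
  by rewrite [in RHS]dvdzE abszN -dvdzE.
rewrite ger0_norm ?subr_ge0 // => h1 h2.
have /andP[a1 a2] := floor_itv a; have /andP[b1 b2] := floor_itv b.
rewrite !rmorphD /= in a2 b2.
set fa := Num.floor a in a1 a2 *; set fb := Num.floor b in b1 b2 *.
have P : (0 < fa - fb)%R.
  by rewrite -(ltr0z R) rmorphB /=; lra.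
have Q : (fa - fb < N%:Z)%R.
  by rewrite -(ltr_int R) rmorphB /=; apply: le_lt_trans h2; lra.
apply/negP => /dvdzP[z E]; rewrite E in P Q.
have N1 : (0 < N%:Z)%R := lt_trans P Q.
have Q1 : (z * N%:Z < 1 * N%:Z)%R by rewrite mul1r.
by move: P Q1; rewrite pmulr_lgt0 // ltr_pM2r //; clear; lia.
Qed.

(** Write a point of level 2k as the image under the word u of the image under the word v.
    Around x u, the image of al under u, the phase is affine up to M (|r| ^ k (be - al)) ^ 2, and
    its slope xi u = r ^ k G1 (x u) multiplies the position Y v. A common ratio makes Y v
    independent of u, whence a bilinear form in e(xi u * Y v). Rounding xi u to
    the grid of mesh eta and Y v to the grid of mesh 1 / (N eta) turns e(xi u * Y v) into
    e(j u * i v / N). The lower bound m on the second derivative separates the xi u, the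
    separation of cylinders separates the Y v; words heavier than q are discarded. *)
Lemma oscillatory_bound (k N : nat) (eta M m q beta theta : R) (G0 G1 G2 : R -> R) y :
  (0 < N)%N -> 0 < eta -> 0 <= q -> 0 < theta ->
  (forall z, al <= z <= be -> is_derive z 1 G0 (G1 z)) ->
  (forall z, al <= z <= be -> is_derive z 1 G1 (G2 z)) ->
  (forall z, al <= z <= be -> `|G1 z| <= M) ->
  (forall z, al <= z <= be -> `|G2 z| <= M) ->
  (forall z, al <= z <= be -> m <= `|G2 z|) ->
  0 <= m ->
  eta <= m * (`|r| ^+ k) ^+ 2 * d0 ->
  1 <= `|r| ^+ k * d0 * N%:R * eta ->
  2 * `|r| ^+ k * M / eta + 1 < N%:R ->
  (be - al) * N%:R * eta + 1 < N%:R ->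
  \sum_(u : word A k | q < wprod p u) wprod p u <= beta ->
  al <= y <= be ->
  `|average r t p k (average r t p k (fun z => ecos (G0 z))) y|
    <= 2 * pi * (M * (`|r| ^+ k * (be - al)) ^+ 2
                 + `|r| ^+ k * M / (N%:R * eta) + eta * (be - al))
       + 2 * beta + (theta / 2 + q ^+ 2 * N%:R / (2 * theta)).
Proof.
move=> N0 eta0 q0 theta0 D0 D1 B1 B2 m2 m0 h1 h2 h3 h4 hb yH.
have aH : al <= al <= be by rewrite lexx ab.
pose P (u : word A k) : R := wprod p u.
have P0 u : 0 <= P u by apply: wprod_ge0; exact: pv_ge0.
have P1 : \sum_u P u = 1 by exact: sum_pw.
have NR : 0 < N%:R :> R by rewrite ltr0n.
pose rk := `|r| ^+ k; have rk0 : 0 < rk by rewrite exprn_gt0.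
have rkE : `|r ^+ k| = rk by rewrite normrX.
pose x (u : word A k) := word_map r t u al.
have xH u : al <= x u <= be by apply: word_map_in.
pose xi u := r ^+ k * G1 (x u).
pose Y u := x u - al.
have Y0 u : 0 <= Y u by rewrite subr_ge0; case/andP: (xH u).
have YL u : Y u <= be - al by rewrite /Y lerB //; case/andP: (xH u).
pose j u := Num.floor (xi u / eta).
pose i u := Num.floor (Y u * (N%:R * eta)).
have M0 : 0 <= M by rewrite (le_trans _ (B1 al aH)).
have xiM u : `|xi u| <= rk * M by rewrite normrM rkE ler_wpM2l ?B1 ?(ltW rk0).
pose th u := G0 (x u) + xi u * (r ^+ k * (y - al)).
have Ne0 : 0 < N%:R * eta by rewrite mulr_gt0.
pose err := M * (rk * (be - al)) ^+ 2 + rk * M / (N%:R * eta) + eta * (be - al).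
have approx u v : `|G0 (word_map r t u (word_map r t v y)) -
    (th u + (j u)%:~R * (i v)%:~R / N%:R)| <= err.
  have vH : al <= word_map r t v y <= be by apply: word_map_in.
  have E1 : word_map r t u (word_map r t v y) - x u = r ^+ k * (word_map r t v y - al).
    by rewrite word_mapB.
  have E2 : G1 (x u) * (word_map r t u (word_map r t v y) - x u)
      = xi u * (r ^+ k * (y - al)) + xi u * Y v.
    by rewrite E1 /xi /Y /x /word_map; ring.
  have L := linearization D0 D1 B2 (xH u) (@word_map_in R A r t al be phiH k u _ vH).
  have L2 : M * (word_map r t u (word_map r t v y) - x u) ^+ 2 <= M * (rk * (be - al)) ^+ 2.
    rewrite ler_wpM2l // -(real_normK (num_real _)) E1 normrM rkE.
    rewrite lerXn2r ?nnegrE ?mulr_ge0 ?(ltW rk0) ?subr_ge0 //.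
    rewrite ler_wpM2l ?(ltW rk0) // ler_norml; case/andP: vH => v1 v2.
    by apply/andP; split; lra.
  have Ljk : `|xi u * Y v - (j u)%:~R * (i v)%:~R / N%:R| <= rk * M / (N%:R * eta) + eta * (be - al).
    have -> : xi u * Y v - (j u)%:~R * (i v)%:~R / N%:R =
      xi u * (Y v - (i v)%:~R / (N%:R * eta))
      + (xi u - (j u)%:~R * eta) * ((i v)%:~R / (N%:R * eta)).
      by field; rewrite !gt_eqF.
    have /andP[i1 i2] := floor_itv (Y v * (N%:R * eta)).
    have /andP[j1 j2] := floor_itv (xi u / eta).
    rewrite -/(i v) -/(j u) !rmorphD /= in i1 i2 j1 j2.
    have i0 : 0 <= (i v)%:~R :> R.
      by rewrite ler0z floor_ge0 mulr_ge0 // ltW.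
    rewrite (le_trans (ler_normD _ _)) // (normrM (xi u)) (normrM (xi u - _)); apply: lerD.
      apply: ler_pM => //.
      rewrite ger0_norm; last by rewrite subr_ge0 ler_pdivrMr.
      rewrite -[leRHS]mul1r lerBlDr -mulrDl ler_pdivlMr // addrC; exact: ltW.
    apply: ler_pM => //; last first.
      rewrite ger0_norm; last by rewrite divr_ge0 // ltW.
      by rewrite (le_trans _ (YL v)) // ler_pdivrMr.
    have : (j u)%:~R * eta <= xi u by rewrite -ler_pdivlMr.
    have : xi u <= (j u)%:~R * eta + eta.
      by rewrite -[X in _ + X]mul1r -mulrDl -ler_pdivrMr // ltW.
    by move=> H1 H2; rewrite ger0_norm; lra.
  have -> : G0 (word_map r t u (word_map r t v y)) - (th u + (j u)%:~R * (i v)%:~R / N%:R)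
    = (G0 (word_map r t u (word_map r t v y))
         - (G0 (x u) + G1 (x u) * (word_map r t u (word_map r t v y) - x u)))
      + (xi u * Y v - (j u)%:~R * (i v)%:~R / N%:R).
    by rewrite E2 /th; ring.
  rewrite (le_trans (ler_normD _ _)) //.
  have -> : err = M * (rk * (be - al)) ^+ 2 + (rk * M / (N%:R * eta) + eta * (be - al)).
    by rewrite /err addrA.
  by apply: lerD => //; exact: le_trans L L2.
pose S := \sum_u \sum_v P u * P v * ecos (th u + (j u)%:~R * (i v)%:~R / N%:R).
have step1 : `|average r t p k (average r t p k (fun z => ecos (G0 z))) y - S| <= 2 * pi * err.
  have -> : average r t p k (average r t p k (fun z => ecos (G0 z))) y =
      \sum_u \sum_v P u * P v * ecos (G0 (word_map r t u (word_map r t v y))).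
    rewrite /average exchange_big /=; apply: eq_bigr => v _.
    by rewrite mulr_sumr; apply: eq_bigr => u _; rewrite /P; ring.
  rewrite /S -sumrB (le_trans (ler_norm_sum _ _ _)) //.
  apply: (@le_trans _ _ (\sum_u \sum_v P u * P v * (2 * pi * err))).
    apply: ler_sum => u _; rewrite -sumrB (le_trans (ler_norm_sum _ _ _)) //.
    apply: ler_sum => v _; rewrite -mulrBr normrM ger0_norm ?mulr_ge0 //.
    rewrite ler_wpM2l ?mulr_ge0 // (le_trans (ecos_lip _ _)) //.
    by rewrite ler_wpM2l // mulr_ge0 // pi_ge0.
  under eq_bigr => u _ do rewrite -mulr_suml -mulr_sumr P1 mulr1.
  by rewrite -mulr_suml P1 mul1r.
pose G : pred (word A k) := fun u => P u <= q.
have nGb : \sum_(u | ~~ G u) P u <= beta.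
  by move: hb; rewrite (eq_bigl (fun u => ~~ G u)) // => u; rewrite /G -ltNge.
have nG0 : 0 <= \sum_(u | ~~ G u) P u by apply: sumr_ge0.
have injj u v : G u -> G v -> (N%:Z %| j u - j v)%Z -> u = v.
  move=> _ _; apply: contraTeq => uv; apply/negbT; apply: floor_sep.
    rewrite -mulrBl normrM normfV (gtr0_norm eta0) ler_pdivlMr // mul1r.
    rewrite -mulrBr normrM rkE.
    have [c [cH _ E]] := mvt_itv D1 (xH v) (xH u).
    rewrite E normrM (le_trans h1) // -/rk [leLHS](_ : _ = rk * (m * (rk * d0))); last by ring.
    rewrite ler_wpM2l ?(ltW rk0) //; apply: ler_pM => //.
    - by rewrite mulr_ge0 // ltW.
    - exact: m2.
    - exact: (word_map_sep r1 phiH d0_gt0 gap).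
  apply: le_lt_trans h3; rewrite lerD2r -mulrBl normrM normfV (gtr0_norm eta0).
  rewrite ler_wpM2r ?invr_ge0 ?(ltW eta0) // (le_trans (ler_normB _ _)) //.
  have := xiM u; have := xiM v; rewrite /rk; lra.
have inji u v : G u -> G v -> (N%:Z %| i u - i v)%Z -> u = v.
  move=> _ _; apply: contraTeq => uv; apply/negbT; apply: floor_sep.
    rewrite -mulrBl normrM (gtr0_norm Ne0) (le_trans h2) // -mulrA ler_wpM2r ?(ltW Ne0) //.
    have -> : Y u - Y v = x u - x v by rewrite /Y; ring.
    exact: (word_map_sep r1 phiH d0_gt0 gap).
  apply: le_lt_trans h4; rewrite lerD2r -mulrBl normrM (gtr0_norm Ne0) -mulrA.
  rewrite ler_wpM2r ?(ltW Ne0) // ler_norml.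
  by have := Y0 u; have := Y0 v; have := YL u; have := YL v => *; apply/andP; split; lra.
have Gq u : G u -> P u <= q by [].
have P1' : \sum_u P u <= 1 by rewrite P1.
have main := bilinear_le N0 th P0 P1' Gq q0 theta0 inji injj.
have step2 : `|S| <= 2 * beta + (theta / 2 + q ^+ 2 * N%:R / (2 * theta)).
  have Ein u : `|\sum_(v | ~~ G v) P u * P v * ecos (th u + (j u)%:~R * (i v)%:~R / N%:R)|
      <= P u * beta.
    apply: (@le_trans _ _ (P u * \sum_(v | ~~ G v) P v)); last by rewrite ler_wpM2l.
    rewrite (le_trans (ler_norm_sum _ _ _)) // mulr_sumr; apply: ler_sum => v _.
    by rewrite normrM ger0_norm ?mulr_ge0 // ler_piMr ?mulr_ge0 // ecos_abs_le1.
  rewrite /S (bigID G) /=.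
  have -> : \sum_(u | G u) \sum_v P u * P v * ecos (th u + (j u)%:~R * (i v)%:~R / N%:R)
    = \sum_(u | G u) \sum_(v | G v) P u * P v * ecos (th u + (j u)%:~R * (i v)%:~R / N%:R)
    + \sum_(u | G u) \sum_(v | ~~ G v) P u * P v * ecos (th u + (j u)%:~R * (i v)%:~R / N%:R).
    by rewrite -big_split /=; apply: eq_bigr => u _; rewrite (bigID G).
  have T2 : `|\sum_(u | G u) \sum_(v | ~~ G v) P u * P v * ecos (th u + (j u)%:~R * (i v)%:~R / N%:R)| <= beta.
    rewrite (le_trans (ler_norm_sum _ _ _)) //.
    apply: (@le_trans _ _ (\sum_u P u * beta)); last by rewrite -mulr_suml P1 mul1r.
    rewrite [leRHS](bigID G) /= -[leLHS]addr0 lerD //; first by apply: ler_sum.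
    by apply: sumr_ge0 => u _; rewrite mulr_ge0 // (le_trans nG0).
  have T3 : `|\sum_(u | ~~ G u) \sum_v P u * P v * ecos (th u + (j u)%:~R * (i v)%:~R / N%:R)| <= beta.
    rewrite (le_trans (ler_norm_sum _ _ _)) // (le_trans _ nGb) //.
    apply: ler_sum => u _; rewrite (le_trans (ler_norm_sum _ _ _)) //.
    rewrite -[leRHS]mulr1 -P1 mulr_sumr; apply: ler_sum => v _.
    by rewrite normrM ger0_norm ?mulr_ge0 // ler_piMr ?mulr_ge0 // ecos_abs_le1.
  rewrite (le_trans (ler_normD _ _)) //.
  have := ler_normD (\sum_(u | G u) \sum_(v | G v) P u * P v * ecos (th u + (j u)%:~R * (i v)%:~R / N%:R))
    (\sum_(u | G u) \sum_(v | ~~ G v) P u * P v * ecos (th u + (j u)%:~R * (i v)%:~R / N%:R)).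
  by move: main T2 T3; lra.
rewrite -(subrK S (average _ _ _ _ _ _)) (le_trans (ler_normD _ _)) // -addrA.
exact: lerD.
Qed.

End Core.

(** * Power decay of oscillatory integrals *)

Lemma expR_ge_lin (R : realType) (K d x : R) : 0 < d -> K / d <= x -> K <= expR (d * x).
Proof.
move=> dp; rewrite ler_pdivrMr // => H.
by have := expR_ge1Dx (d * x); rewrite mulrC in H; lra.
Qed.

(** Choice of the parameters in [oscillatory_bound]. Here exp x is the size of the phase.
    With |r| ^ (2 k) close to exp(- (1 + e) x) the linearization error is exp(- e x), the
    frequencies range over an interval of length about exp(x / 2) and are separated by
    exp(- 2 e x) up to constants. Typical words have weight q about |r| ^ (k D), where D
    is the ratio of the entropy to - ln |r|, hence q ^ 2 N is about exp((1/2 - D + 4 e) x),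
    a negative power of exp x when D > 1/2 and e is small. *)
Lemma oscillatory_decay (R : realType) (A : finType) (r : R) (t : A -> R) (p : A -> R)
  (al be d0 : R) :
  0 < `|r| -> `|r| < 1 -> al <= be ->
  (forall i y, al <= y <= be -> al <= r * y + t i <= be) ->
  0 < d0 -> (forall i j, i != j -> `|r| * (be - al) + d0 <= `|t i - t j|) ->
  probability_vector p -> 1 / 2 < entropy p / - ln `|r| ->
  exists e c C x0 : R, [/\ 0 < e, e < 1, 0 < c, 0 <= C &
  forall x, x0 <= x -> exists k, forall G0 G1 G2 : R -> R,
  (forall z, al <= z <= be -> is_derive z 1 G0 (G1 z)) ->
  (forall z, al <= z <= be -> is_derive z 1 G1 (G2 z)) ->
  (forall z, al <= z <= be -> `|G1 z| <= expR x) ->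
  (forall z, al <= z <= be -> `|G2 z| <= expR x) ->
  (forall z, al <= z <= be -> expR ((1 - e) * x) <= `|G2 z|) ->
  forall y, al <= y <= be ->
  `|average r t p k (average r t p k (fun z => ecos (G0 z))) y| <= C * expR (- (c * x))].
Proof.
move=> r0 r1 ab phiH d0_gt0 gap hp hent.
pose lam := - ln `|r|.
have lam0 : 0 < lam by rewrite oppr_gt0 ln_lt0 // r0 r1.
(* half of the excess of the dimension over 1/2 *)
pose w := (entropy p / lam - 1 / 2) / 2.
have w0 : 0 < w by rewrite divr_gt0 // subr_gt0.
have hw : entropy p = lam * (1 / 2 + 2 * w) by rewrite /w; field; rewrite gt_eqF.
have [c0 c00 atyp] := atypical_mass hp (mulr_gt0 lam0 w0).
rewrite (_ : entropy p - lam * w = lam * (1 / 2 + w)) in atyp; last by rewrite hw; ring.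
pose e := Num.min (w / 8) (1 / 4).
have e0 : 0 < e by rewrite lt_min; apply/andP; split; lra.
have ew : e <= w / 8 by rewrite ge_min lexx.
have e1 : e <= 1 / 4 by rewrite ge_min lexx orbT.
pose Lh := be - al.
have Lh0 : 0 <= Lh by rewrite subr_ge0.
(* every requirement that x be large follows from exp(e x / 2) >= K *)
pose K := expR (2 * lam) / d0 + expR lam / d0 + 2 * Lh + 4.
have [K1 K2 K3] : [/\ expR (2 * lam) / d0 <= K, expR lam / d0 <= K & 2 * Lh <= K /\ 4 <= K].
  have : 0 <= expR (2 * lam) / d0 by rewrite divr_ge0 ?expR_ge0 // ltW.
  have : 0 <= expR lam / d0 by rewrite divr_ge0 ?expR_ge0 // ltW.
  by rewrite /K => *; split; [lra|lra|split; lra].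
pose c := Num.min e (c0 / (2 * lam)).
exists e, c, (2 * pi * (Lh ^+ 2 + 1 + Lh) + 4), (K / (e / 2)).
have pi0 : 0 <= pi :> R := pi_ge0 R.
have C0 : 0 <= 2 * pi * (Lh ^+ 2 + 1 + Lh) by apply: mulr_ge0; [exact: mulr_ge0|have := sqr_ge0 Lh; lra].
split=> //; first by lra.
- by rewrite lt_min e0 divr_gt0 // mulr_gt0.
- by rewrite addr_ge0.
move=> x xK.
have eK := expR_ge_lin (divr_gt0 e0 (ltr0n R 2)) xK.
have x0 : 0 <= x.
  by rewrite (le_trans _ xK) // divr_ge0 ?divr_ge0 ?(ltW e0) //; case: K3; lra.
have ex0 : 0 <= e * x by rewrite mulr_ge0 // ltW.
have wx0 : 8 * (e * x) <= w * x by rewrite mulrA ler_wpM2r //; lra.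
have mono (a : R) : e / 2 * x <= a -> K <= expR a.
  by move=> H; rewrite (le_trans eK) // ler_expR.
have [k [kl1 kl2]] : exists k : nat,
    (1 + e) * x / 2 <= k%:R * lam /\ k%:R * lam <= (1 + e) * x / 2 + lam.
  pose z := (1 + e) * x / (2 * lam).
  have z0 : 0 <= z by apply: divr_ge0; [apply: mulr_ge0 => //; lra|lra].
  have zE : z * lam = (1 + e) * x / 2 by rewrite /z; field; rewrite gt_eqF.
  exists (Num.trunc z).+1; rewrite -zE; split.
    by rewrite ler_wpM2r ?(ltW lam0) // ltW // truncnS_gt.
  rewrite -[X in _ <= _ + X]mul1r -mulrDl ler_wpM2r ?(ltW lam0) //.
  by rewrite -[leLHS]natr1 lerD2r truncn_le.
have rkE : `|r| ^+ k = expR (- (k%:R * lam)).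
  by rewrite /lam mulrN opprK expRM_natl lnK ?posrE.
have rk_hi : `|r| ^+ k <= expR (- ((1 + e) * x / 2)) by rewrite rkE ler_expR lerN2.
have rk_lo : expR (- ((1 + e) * x / 2) - lam) <= `|r| ^+ k.
  by rewrite rkE ler_expR -opprD lerN2.
(* mesh for the frequencies, below their separation exp(- 2 e x) up to constants *)
pose eta := expR (- (3 * (e * x))).
have eta0 : 0 < eta by exact: expR_gt0.
(* N, about exp T, exceeds the number of frequency cells *)
pose T := x / 2 + 4 * (e * x).
have T0 : 0 <= T by rewrite /T; lra.
have [N [N0 N_lo N_hi]] : exists N : nat,
    [/\ (0 < N)%N, expR T <= N%:R & N%:R <= 2 * expR T].
  exists (Num.trunc (expR T)).+1; split=> //; first by rewrite ltW // truncnS_gt.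
  rewrite -[leLHS]natr1 mulr_natl mulr2n lerD ?truncn_le ?expR_ge0 //.
  by rewrite -[leLHS]expR0 ler_expR.
have NR : 0 < N%:R :> R by rewrite ltr0n.
exists k => G0 G1 G2 D0 D1 B1 B2 B3 y yH.
pose q := expR (- (k%:R * (lam * (1 / 2 + w)))).
(* balances the two terms of the bilinear bound *)
pose th := expR (- (2 * (e * x))).
have h1 : eta <= expR ((1 - e) * x) * (`|r| ^+ k) ^+ 2 * d0.
  apply: (@le_trans _ _ (expR ((1 - e) * x) * (expR (- ((1 + e) * x / 2) - lam)) ^+ 2 * d0)); last first.
    by rewrite ler_wpM2r ?(ltW d0_gt0) // ler_wpM2l ?expR_ge0 // lerXn2r // ?nnegrE ?expR_ge0 // exprn_ge0.
  rewrite -expRM_natl -expRD -ler_pdivrMr // -[eta]mulr1.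
  have -> : (1 - e) * x + 2%:R * (- ((1 + e) * x / 2) - lam) = - (3 * (e * x)) + (e * x - 2 * lam) by field.
  rewrite expRD -mulrA ler_wpM2l ?expR_ge0 // expRD expRN ler_pdivlMr ?expR_gt0 //.
  rewrite mul1r mulrC (le_trans K1) //; apply: mono; clear - ex0; lra.
have h2 : 1 <= `|r| ^+ k * d0 * N%:R * eta.
  apply: (@le_trans _ _ (expR (- ((1 + e) * x / 2) - lam) * d0 * expR T * eta)); last first.
    rewrite ler_wpM2r ?(ltW eta0) // ler_pM ?mulr_ge0 ?expR_ge0 ?(ltW d0_gt0) //.
    by rewrite ler_wpM2r // ltW.
  have -> : expR (- ((1 + e) * x / 2) - lam) * d0 * expR T * eta =
     expR (- ((1 + e) * x / 2) - lam + T - (3 * (e * x))) * d0.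
    by rewrite !expRD /eta; ring.
  have -> : - ((1 + e) * x / 2) - lam + T - (3 * (e * x)) = e * x / 2 - lam by rewrite /T; field.
  rewrite expRD expRN mulrAC ler_pdivlMr ?expR_gt0 // mul1r -ler_pdivrMr //.
  by rewrite (le_trans K2) //; apply: mono; clear - ex0; lra.
have h3 : 2 * `|r| ^+ k * expR x / eta + 1 < N%:R.
  apply: lt_le_trans N_lo.
  pose E := expR (x / 2 + 5 / 2 * (e * x)).
  have E1 : 1 <= E by rewrite -[leLHS]expR0 ler_expR; clear - ex0 x0; lra.
  apply: (@le_lt_trans _ _ (3 * E)).
    have : `|r| ^+ k * expR x / eta <= E.
      apply: (@le_trans _ _ (expR (- ((1 + e) * x / 2)) * expR x / eta)).
        by rewrite ler_wpM2r ?invr_ge0 ?(ltW eta0) // ler_wpM2r ?expR_ge0.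
      by rewrite /eta -expRN -!expRD ler_expR; clear - ex0 x0; lra.
    by rewrite -!mulrA => H; clear - H E1; lra.
  have -> : T = (x / 2 + 5 / 2 * (e * x)) + 3 / 2 * (e * x) by rewrite /T; field.
  rewrite expRD -/E mulrC ltr_pM2l ?expR_gt0 //.
  by apply: (@lt_le_trans _ _ K); [case: K3; clear; lra|apply: mono; clear - ex0; lra].
have h4 : (be - al) * N%:R * eta + 1 < N%:R.
  have Le : Lh * eta <= 1 / 2.
    rewrite /eta expRN ler_pdivrMr ?expR_gt0 //.
    have : K <= expR (3 * (e * x)) by apply: mono; clear - ex0; lra.
    by case: K3; clear; lra.
  have N4 : 4 <= N%:R :> R.
    by apply: (le_trans _ N_lo); apply: (@le_trans _ _ K); [case: K3|apply: mono; rewrite /T; clear - ex0 x0; lra].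
  rewrite mulrAC -/Lh.
  have : Lh * eta * N%:R <= 1 / 2 * N%:R by rewrite ler_wpM2r // ltW.
  by move: N4; clear; lra.
have := oscillatory_bound r0 r1 ab phiH d0_gt0 gap hp N0 eta0 (expR_ge0 _ : 0 <= q)
  (expR_gt0 _ : 0 < th) D0 D1 B1 B2 B3 (expR_ge0 _) h1 h2 h3 h4 (atyp k) yH.
move/le_trans; apply; rewrite -/Lh.
have cx : c * x <= e * x by rewrite ler_wpM2r // ge_min lexx.
have F1 : expR x * (`|r| ^+ k * Lh) ^+ 2 <= Lh ^+ 2 * expR (- (c * x)).
  rewrite exprMn mulrA mulrC ler_wpM2l ?sqr_ge0 //.
  apply: (@le_trans _ _ (expR x * expR (- ((1 + e) * x / 2)) ^+ 2)).
    by rewrite ler_wpM2l ?expR_ge0 // lerXn2r // ?nnegrE ?expR_ge0 // exprn_ge0.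
  by rewrite -expRM_natl -expRD ler_expR; clear - cx; lra.
have F2 : `|r| ^+ k * expR x / (N%:R * eta) <= expR (- (c * x)).
  rewrite ler_pdivrMr ?mulr_gt0 //.
  apply: (@le_trans _ _ (expR (- ((1 + e) * x / 2)) * expR x)).
    by rewrite ler_wpM2r ?expR_ge0.
  apply: (@le_trans _ _ (expR (- (c * x)) * (expR T * eta))); last first.
    by rewrite ler_wpM2l ?expR_ge0 // ler_wpM2r // ltW.
  by rewrite /eta -!expRD ler_expR /T; clear - cx ex0 x0; lra.
have F3 : eta * Lh <= Lh * expR (- (c * x)).
  by rewrite mulrC ler_wpM2l // ler_expR; clear - cx ex0; lra.
have F4 : expR (- (c0 * k%:R)) <= expR (- (c * x)).
  rewrite ler_expR lerN2.
  have : c * x <= c0 / (2 * lam) * x by rewrite ler_wpM2r // ge_min lexx orbT.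
  have : c0 / (2 * lam) * x <= c0 * k%:R.
    rewrite mulrAC -mulrA ler_wpM2l ?(ltW c00) // ler_pdivrMr ?mulr_gt0 //.
    by move: kl1 ex0 x0; clear; lra.
  clear; lra.
have F5 : th / 2 + q ^+ 2 * N%:R / (2 * th) <= 2 * expR (- (c * x)).
  have t1 : th <= expR (- (c * x)) by rewrite ler_expR; clear - cx ex0; lra.
  have q1 : q ^+ 2 * N%:R <= 2 * expR (- (4 * (e * x))).
    apply: (@le_trans _ _ (q ^+ 2 * (2 * expR T))); first by rewrite ler_wpM2l ?sqr_ge0.
    rewrite [leLHS]mulrCA ler_wpM2l // /q -expRM_natl -expRD ler_expR.
    have : x / 2 * (1 / 2 + w) <= k%:R * (lam * (1 / 2 + w)).
      by rewrite mulrA ler_wpM2r //; move: kl1 ex0 w0; clear; lra.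
    by move: ex0 wx0; rewrite /T; clear; lra.
  have q2 : q ^+ 2 * N%:R / (2 * th) <= th.
    rewrite ler_pdivrMr ?mulr_gt0 ?expR_gt0 // (le_trans q1) //.
    by rewrite [leRHS]mulrCA ler_wpM2l // /th -expRD ler_expR; clear; lra.
  have := expR_ge0 (- (2 * (e * x))); rewrite -/th.
  by move: t1 q2; clear; lra.
have F6 : 2 * pi * (expR x * (`|r| ^+ k * Lh) ^+ 2 + `|r| ^+ k * expR x / (N%:R * eta) + eta * Lh)
    <= 2 * pi * (Lh ^+ 2 + 1 + Lh) * expR (- (c * x)).
  rewrite -[leRHS]mulrA; apply: ler_wpM2l; first exact: mulr_ge0.
  rewrite [leRHS]mulrDl [X in _ <= X + _]mulrDl mul1r.
  by apply: lerD => //; apply: lerD.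
rewrite [leRHS]mulrDl; move: F4 F5 F6; set E := expR (- (c * x)) => F4 F5 F6.
apply: le_trans (lerD (lerD F6 (ler_wpM2l _ F4)) F5) _ => //.
by clear; lra.
Qed.

(** * Integrals of bounded functions against a self-similar measure *)

Section SelfSimilarIntegral.
Variables (R : realType) (A : finType) (r : R) (t : A -> R) (p : A -> R).
Variable mu : probability (measurableTypeR R) R.
Hypothesis hp : probability_vector p.
Hypothesis hmu : is_self_similar_measure (equicontractive_ifs r t) p mu.

Lemma measurable_affine (a b : R) :
  measurable_fun [set: measurableTypeR R] (fun x : measurableTypeR R => a * x + b : measurableTypeR R).
Proof.
apply: measurable_realfun.continuous_measurable_fun => x.
by apply: cvgD; [apply: cvgMl_tmp; exact: cvg_id | exact: cvg_cst].
Qed.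

(** The measure mu is the finite sum of the scaled distributions of the maps of the system. *)
Lemma ge0_integral_selfsim (F : measurableTypeR R -> \bar R) :
  measurable_fun [set: measurableTypeR R] F -> (forall x, 0 <= F x)%E ->
  (\int[mu]_x F x = \sum_i (p i)%:E * \int[mu]_x F (r * x + t i)%R)%E.
Proof.
move=> mF F0.
have [i0 _] : exists i : A, true.
  apply/existsP; rewrite -[[exists _, _]]negbK negb_exists; apply/negP => /forallP H.
  have := pv_sum hp; rewrite big1 => [/esym/eqP|i _]; first by rewrite oner_eq0.
  by have := H i.
pose X i : {mfun measurableTypeR R >-> measurableTypeR R} :=
  mfun_Sub (mem_set (measurable_affine r (t i))).
pose m_ (n : nat) : {measure set (measurableTypeR R) -> \bar R} :=
  mscale (NngNum (pv_ge0 hp (nth i0 (enum A) n))) (distribution mu (X (nth i0 (enum A) n))).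
have sumE (G : A -> \bar R) : (\sum_i G i = \sum_(n < #|A|) G (nth i0 (enum A) n))%E.
  by rewrite -big_enum /= (big_nth i0) big_mkord -cardE.
rewrite (@eq_measure_integral _ _ _ setT (msum m_ #|A|)); last first.
  by move=> B mB _; have H := hmu mB; rewrite sumE in H; exact: H.
rewrite ge0_integral_measure_sum // sumE; apply: eq_bigr => n _.
rewrite ge0_integral_mscale //=; congr (_ * _)%E.
by rewrite ge0_integral_distribution.
Qed.

Definition bounded_measurable (F : R -> R) := 
  measurable_fun [set: measurableTypeR R] (F : measurableTypeR R -> measurableTypeR R)
  /\ exists M : R, forall x, `|F x| <= M.

Definition expect (F : R -> R) : R := (\int[mu]_x F x)%R.

Lemma bm_integrable F : bounded_measurable F ->
  mu.-integrable setT (EFin \o (F : measurableTypeR R -> R)).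
Proof.
move=> [mF [M FM]]; apply: measurable_bounded_integrable => //.
  by apply: (@le_lt_trans _ _ 1%E); [exact: probability_le1|exact: ltry].
exists M; split; first exact: num_real.
by move=> N MN x _; apply: le_trans (FM x) (ltW MN).
Qed.

Lemma bm_cst c : bounded_measurable (fun=> c).
Proof. by split; [exact: measurable_cst|exists `|c|]. Qed.

Lemma bmD F G : bounded_measurable F -> bounded_measurable G -> bounded_measurable (fun x => F x + G x).
Proof.
move=> [mF [M FM]] [mG [N GN]]; split; first exact: measurable_funD.
by exists (M + N) => x; rewrite (le_trans (ler_normD _ _)) // lerD.
Qed.

Lemma bmM F G : bounded_measurable F -> bounded_measurable G -> bounded_measurable (fun x => F x * G x).
Proof.
move=> [mF [M FM]] [mG [N GN]]; split; first exact: measurable_funM.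
by exists (M * N) => x; rewrite normrM ler_pM.
Qed.

Lemma bm_sum (I : Type) (s : seq I) (P : pred I) (F : I -> R -> R) :
  (forall i, bounded_measurable (F i)) -> bounded_measurable (fun x => \sum_(i <- s | P i) F i x).
Proof.
move=> H; elim: s => [|i s IH].
  by under eq_fun do rewrite big_nil; exact: bm_cst.
under eq_fun do rewrite big_cons.
by case: (P i) => //; exact: bmD.
Qed.

Lemma bm_comp F a b : bounded_measurable F -> bounded_measurable (fun x => F (a * x + b)).
Proof.
move=> [mF [M FM]]; split; last by exists M.
exact: (measurableT_comp mF (measurable_affine a b)).
Qed.

Lemma expect_cst c : expect (fun=> c) = c.
Proof. rewrite /expect Rintegral_cst //.
rewrite -[RHS]mulr1; congr (_ * _).
exact: (congr1 fine (probability_setT mu)). Qed.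

Lemma expectD F G : bounded_measurable F -> bounded_measurable G ->
  expect (fun x => F x + G x) = expect F + expect G.
Proof. by move=> bF bG; rewrite /expect RintegralD //; exact: bm_integrable. Qed.

Lemma expectZ c F : bounded_measurable F -> expect (fun x => c * F x) = c * expect F.
Proof. by move=> bF; rewrite /expect RintegralZl //; exact: bm_integrable. Qed.

Lemma expect_sum (I : Type) (s : seq I) (P : pred I) (F : I -> R -> R) :
  (forall i, bounded_measurable (F i)) ->
  expect (fun x => \sum_(i <- s | P i) F i x) = \sum_(i <- s | P i) expect (F i).
Proof.
move=> H; elim: s => [|i s IH].
  by under eq_fun do rewrite big_nil; rewrite big_nil expect_cst.
under eq_fun do rewrite big_cons; rewrite big_cons -IH.
by case: (P i) => //; rewrite expectD //; exact: bm_sum.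
Qed.

Lemma expect_EFin F : bounded_measurable F -> (expect F)%:E = (\int[mu]_x (F x)%:E)%E.
Proof.
move=> bF; rewrite /expect /Rintegral fineK //.
by apply: integrable_fin_num => //; exact: bm_integrable.
Qed.

(** Adding a constant reduces to a nonnegative function. *)
Lemma expect_selfsim F : bounded_measurable F ->
  expect F = \sum_i p i * expect (fun x => F (r * x + t i)).
Proof.
move=> bF; have [mF [M FM]] := bF.
pose F1 x := F x + M.
have bF1 : bounded_measurable F1 by apply: bmD => //; exact: bm_cst.
have H : expect F1 = \sum_i p i * expect (fun x => F1 (r * x + t i)).
  apply: EFin_inj; rewrite expect_EFin // ge0_integral_selfsim.
  - rewrite -sumEFin; apply: eq_bigr => i _; rewrite EFinM expect_EFin //.
    exact: bm_comp.
  - by apply/measurable_EFinP; case: bF1.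
  - move=> x; rewrite lee_fin /F1; have := FM x; rewrite ler_norml => /andP[]; lra.
have HM : expect F1 = expect F + M by rewrite /F1 expectD ?expect_cst //; exact: bm_cst.
have Hi i : expect (fun x => F1 (r * x + t i)) = expect (fun x => F (r * x + t i)) + M.
  by rewrite /F1 expectD ?expect_cst //; [exact: bm_comp|exact: bm_cst].
move: H; rewrite HM; under eq_bigr do rewrite Hi mulrDr.
by rewrite big_split /= -mulr_suml (pv_sum hp) mul1r => /addIr.
Qed.

Lemma bm_average k F : bounded_measurable F -> bounded_measurable (average r t p k F).
Proof.
move=> bF; apply: bm_sum => u; apply: bmM; first exact: bm_cst.
exact: bm_comp.
Qed.

Lemma expect_average k F : bounded_measurable F -> expect F = expect (average r t p k F).
Proof.
elim: k F => [|k IH] F bF.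
  congr expect; apply/funext => y.
  rewrite /average (big_pred1 tt) => [|[]] //.
  by rewrite /word_map /= expr0 mul1r addr0 mul1r.
rewrite expect_selfsim //.
have -> : average r t p k.+1 F
    = (fun y => \sum_i p i * average r t p k (fun x => F (r * x + t i)) y).
  apply/funext => y; rewrite /average sum_word; apply: eq_bigr => i _.
  by rewrite mulr_sumr; apply: eq_bigr => u _; rewrite word_mapS /= mulrA.
rewrite expect_sum.
  apply: eq_bigr => i _; rewrite expectZ; last by apply: bm_average; exact: bm_comp.
  by rewrite -IH //; exact: bm_comp.
by move=> i; apply: bmM; [exact: bm_cst|apply: bm_average; exact: bm_comp].
Qed.

End SelfSimilarIntegral.

(** * Support, absence of atoms and a Borel-Cantelli argument *)

Section SelfSimilarSupport.
Variables (R : realType) (A : finType) (r : R) (t : A -> R) (p : A -> R).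
Variable mu : probability (measurableTypeR R) R.
Hypothesis hp : probability_vector p.
Hypothesis hmu : is_self_similar_measure (equicontractive_ifs r t) p mu.
Variables (al be d0 : R).
Hypothesis r0 : 0 < `|r|.
Hypothesis r1 : `|r| < 1.
Hypothesis ab : al <= be.
Hypothesis phiH : forall i y, al <= y <= be -> al <= r * y + t i <= be.
Hypothesis d0_gt0 : 0 < d0.
Hypothesis gap : forall i j, i != j -> `|r| * (be - al) + d0 <= `|t i - t j|.
Hypothesis h0 : 0 < entropy p.

Notation expect := (expect mu).

Lemma ae_imply (P Q : R -> Prop) :
  {ae mu, forall x, P x} -> (forall x, P x -> Q x) -> {ae mu, forall x, Q x}.
Proof.
move=> aeP PQ; apply: negligibleS aeP => x /= nQ Px; exact: nQ (PQ _ Px).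
Qed.

Lemma expect_ge0 F : (forall x, 0 <= F x) -> 0 <= expect F.
Proof. by move=> F0; apply: Rintegral_ge0. Qed.

Lemma expect_eq0_ae F : bounded_measurable F -> (forall x, 0 <= F x) -> expect F = 0 ->
  {ae mu, forall x, F x = 0}.
Proof.
move=> bF F0 EF; have mF : measurable_fun [set: measurableTypeR R] (EFin \o (F : measurableTypeR R -> R)).
  by apply/measurable_EFinP; case: bF.
have : (\int[mu]_(x in setT) `|(EFin \o (F : measurableTypeR R -> R)) x| = 0)%E.
  under eq_integral => x _ do rewrite /= ger0_norm //.
  by rewrite -(expect_EFin mu bF) EF.
move/(ae_eq_integral_abs mu measurableT mF) => H.
by apply: filterS H => x /= /(_ I) [].
Qed.

(** Distance from x to the interval [al, be]. *)
Definition hdist (x : R) : R := Num.max 0 (Num.max (al - x) (x - be)).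

Lemma hdist_ge0 x : 0 <= hdist x.
Proof. by rewrite le_max lexx. Qed.

Lemma hdist_eq0 x : hdist x = 0 -> al <= x <= be.
Proof.
rewrite /hdist => H; have : Num.max (al - x) (x - be) <= 0.
  by rewrite -[leRHS]H le_max lexx orbT.
by rewrite ge_max => /andP[? ?]; apply/andP; split; lra.
Qed.

Lemma hdist_le x y : al <= y <= be -> hdist x <= `|x - y|.
Proof.
move=> /andP[y1 y2]; rewrite !ge_max normr_ge0 /=.
have := ler_norm (x - y); have := ler_norm (y - x); rewrite distrC => *.
by apply/andP; split; lra.
Qed.

Lemma hdist_attained x : exists2 y, al <= y <= be & hdist x = `|x - y|.
Proof.
have H y : al <= y <= be -> `|x - y| <= hdist x -> exists2 y, al <= y <= be & hdist x = `|x - y|.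
  by move=> yH xy; exists y => //; apply/eqP; rewrite eq_le hdist_le.
have [xa|xa] := ltP x al.
  apply: (H al); first by rewrite lexx ab.
  by rewrite ltr0_norm ?subr_lt0 // opprB /hdist !le_max lexx orbT.
have [xb|xb] := ltP be x.
  apply: (H be); first by rewrite ab lexx.
  by rewrite gtr0_norm ?subr_gt0 // /hdist !le_max lexx !orbT.
by apply: (H x); rewrite ?xa ?xb // subrr normr0 hdist_ge0.
Qed.

Lemma hdist_affine i x : hdist (r * x + t i) <= `|r| * hdist x.
Proof.
have [y yH ->] := hdist_attained x.
rewrite -normrM (le_trans (hdist_le _ (phiH i yH))) //.
by rewrite le_eqVlt; apply/orP; left; apply/eqP; congr Num.norm; ring.
Qed.

Lemma bm_exp_hdist c : 0 <= c -> bounded_measurable (fun x => expR (- (c * hdist x))).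
Proof.
move=> c0; split; last first.
  exists 1 => x; rewrite ger0_norm ?expR_ge0 // -[leRHS]expR0 ler_expR oppr_le0.
  by rewrite mulr_ge0 // hdist_ge0.
have mh : measurable_fun [set: measurableTypeR R] (fun x : measurableTypeR R => - (c * hdist x) : measurableTypeR R).
  apply: measurable_funN; apply: measurable_funM; first exact: measurable_cst.
  apply: measurable_maxr; first exact: measurable_cst.
  apply: measurable_maxr.
    by apply: measurable_funB; [exact: measurable_cst|exact: measurable_id].
  by apply: measurable_funB; [exact: measurable_id|exact: measurable_cst].
have me : measurable_fun [set: measurableTypeR R] (expR : measurableTypeR R -> measurableTypeR R).
  exact: measurable_expR.
exact: (measurableT_comp me mh).
Qed.

(** The maps contract the distance to [al, be] by |r|. Invariance of mu therefore gives
    E exp(- hdist) >= E exp(- |r| hdist), whereas exp(- hdist) <= exp(- |r| hdist) pointwise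
    with equality only where hdist vanishes. *)
Lemma support_ae : {ae mu, forall x, al <= x <= be}.
Proof.
(* F0 o phi_i >= F1 >= F0, while the p-average of the F0 o phi_i has the same integral as F0 *)
pose F0 x := expR (- (1 * hdist x)); pose F1 x := expR (- (`|r| * hdist x)).
have b0 : bounded_measurable F0 by apply: bm_exp_hdist.
have b1 : bounded_measurable F1 by apply: bm_exp_hdist; exact: ltW.
pose G x := F1 x + (-1) * F0 x.
have bG0 : bounded_measurable (fun x => (-1) * F0 x) by apply: bmM => //; exact: bm_cst.
have bG : bounded_measurable G by apply: bmD.
have G0 x : 0 <= G x.
  rewrite /G mulN1r subr_ge0 ler_expR lerN2 ler_wpM2r ?hdist_ge0 //.
  exact: ltW.
have EG : expect G = 0.
  apply/eqP; rewrite eq_le expect_ge0 // andbT /G expectD // expectZ // mulN1r subr_le0.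
  rewrite (expect_selfsim hp hmu b0) -[leLHS]mul1r -(pv_sum hp) mulr_suml.
  apply: ler_sum => i _; rewrite ler_wpM2l ?(pv_ge0 hp) //.
  rewrite -subr_ge0 -mulN1r -expectZ // -expectD //; last 2 first.
  - exact: bm_comp.
  - by apply: bmM => //; exact: bm_cst.
  apply: expect_ge0 => x; rewrite mulN1r subr_ge0 ler_expR lerN2 mul1r.
  exact: hdist_affine.
apply: (ae_imply (expect_eq0_ae bG G0 EG)) => x /eqP.
rewrite /G mulN1r subr_eq0 => /eqP/expR_inj/oppr_inj => H; apply: hdist_eq0.
have : (1 - `|r|) * hdist x = 0 by rewrite mulrBl H subrr.
by move/eqP; rewrite mulf_eq0 subr_eq0 gt_eqF //= => /eqP.
Qed.

Lemma expect_ge0_H F : bounded_measurable F -> (forall x, al <= x <= be -> 0 <= F x) -> 0 <= expect F.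
Proof.
move=> bF F0; pose F' x := Num.max 0 (F x).
have mF' : measurable_fun [set: measurableTypeR R] (F' : measurableTypeR R -> measurableTypeR R).
  by apply: measurable_maxr; [exact: measurable_cst|case: bF].
have -> : expect F = expect F'.
  rewrite /expect /Rintegral; congr fine; apply: ae_eq_integral => //.
  - by apply/measurable_EFinP; case: bF.
  - exact/measurable_EFinP.
  by apply: (ae_imply support_ae) => x xH _; rewrite /F' max_r // F0.
by apply: expect_ge0 => x; rewrite le_max lexx.
Qed.

Lemma expect_le_H F G : bounded_measurable F -> bounded_measurable G ->
  (forall x, al <= x <= be -> F x <= G x) -> expect F <= expect G.
Proof.
move=> bF bG FG; have bN : bounded_measurable (fun x => (-1) * F x) by apply: bmM => //; exact: bm_cst.
rewrite -subr_ge0 -mulN1r -expectZ // -expectD //; apply: expect_ge0_H; first exact: bmD.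
by move=> x xH; rewrite mulN1r subr_ge0 FG.
Qed.

Lemma bm_indic (B : set (measurableTypeR R)) : measurable B -> bounded_measurable (\1_B : R -> R).
Proof.
move=> mB; split; first exact: measurable_indic.
by exists 1 => x; rewrite indicE ger0_norm // lern1 leq_b1.
Qed.

Lemma expect_indic (B : set (measurableTypeR R)) : measurable B -> mu B = (expect (\1_B : R -> R))%:E.
Proof. by move=> mB; rewrite (expect_EFin mu (bm_indic mB)) integral_indic // setIT. Qed.

(** At most one of the preimages of x under the maps lies in [al, be], so the largest atom shrinks
    by the factor max p < 1 at each generation. *)
Lemma atomless x : mu [set x] = 0%E.
Proof.
pose q := \big[Num.max/0]_i p i.
have q0 : 0 <= q by exact: bigmax_ge_id.
have q1 : q < 1 by apply: bigmax_lt => // i _; exact: pv_lt1.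
have pq i : p i <= q by exact: le_bigmax.
have m1 (z : R) : measurable ([set z] : set (measurableTypeR R)) by exact: measurable_set1.
pose e (z : R) : R := expect (\1_[set z] : R -> R).
have e0 z : 0 <= e z by apply: expect_ge0 => y; rewrite indicE.
have r_neq0 : r != 0 by rewrite -normr_gt0.
have eout z : ~~ (al <= z <= be) -> e z = 0.
  move=> zH; apply/eqP; rewrite eq_le e0 andbT.
  rewrite -(expect_cst mu 0); apply: expect_le_H => [||y yH]; [exact: bm_indic|exact: bm_cst|].
  rewrite indicE; case: (boolP (y \in [set z])) => // /set_mem yz.
  by move: zH; rewrite -yz yH.
have einv z : e z = \sum_i p i * e ((z - t i) / r).
  rewrite /e (expect_selfsim hp hmu (bm_indic (m1 z))); apply: eq_bigr => i _; congr (_ * _).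
  congr expect; apply/funext => y; rewrite !indicE; congr (nat_of_bool _)%:R.
  apply/idP/idP => /set_mem H; apply/mem_set; rewrite /=.
    by rewrite -H addrK mulrAC divff // mul1r.
  by rewrite H mulrCA divff // mulr1 subrK.
have ek k : forall z, e z <= q ^+ k.
  elim: k => [|k IH] z.
    rewrite expr0 -(expect_cst mu 1); apply: expect_le_H => [||y _]; [exact: bm_indic|exact: bm_cst|].
    by rewrite indicE lern1 leq_b1.
  rewrite einv; have [i iH|none] := pickP (fun i => al <= (z - t i) / r <= be).
    rewrite (bigD1 i) //= big1 ?addr0; first by rewrite exprS ler_pM // (pv_ge0 hp).
    move=> j ji; rewrite eout ?mulr0 //; apply/negP => jH.
    rewrite eq_sym in ji; have := letter_sep gap iH jH ji.
    have rK a : r * (a / r) = a by rewrite mulrC divfK.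
    rewrite !rK !subrK subrr normr0.
    by rewrite leNgt d0_gt0.
  rewrite big1 ?exprn_ge0 // => i _; rewrite eout ?mulr0 //.
  by rewrite none.
rewrite (expect_indic (m1 x)) -/(e x); congr (_%:E).
apply/eqP; rewrite eq_le e0 andbT.
have c : q ^+ k @[k --> \oo] --> (0 : R) by apply: cvg_expr; rewrite ger0_norm.
rewrite leNgt; apply/negP => ex0.
near \oo => k.
have : q ^+ k < e x by near: k; exact: (cvgr_lt _ c).
by rewrite ltNge ek.
Unshelve. all: by end_near. Qed.

(** The series of the F k has finite integral, hence converges almost everywhere. *)
Lemma borel_cantelli_ae (F : nat -> R -> R) (C : R) :
  (forall k, bounded_measurable (F k)) -> (forall k x, 0 <= F k x) ->
  (forall n, \sum_(k < n) expect (F k) <= C) ->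
  {ae mu, forall x, F k x @[k --> \oo] --> (0 : R)}.
Proof.
move=> bF F0 FC.
pose Phi (x : measurableTypeR R) : \bar R := (\sum_(0 <= k <oo) (F k x)%:E)%E.
have mF k : measurable_fun [set: measurableTypeR R] (fun x : measurableTypeR R => (F k x)%:E).
  by apply/measurable_EFinP; case: (bF k).
have Phi0 x : (0 <= Phi x)%E by apply: nneseries_ge0 => k _ _; rewrite lee_fin.
have mPhi : measurable_fun [set: measurableTypeR R] Phi.
  by apply: ge0_emeasurable_sum => // k x _ _; rewrite lee_fin.
have iPhi : (\int[mu]_x Phi x <= C%:E)%E.
  rewrite integral_nneseries //; last by move=> k x _; rewrite lee_fin.
  apply: lime_le.
    by apply: is_cvg_nneseries => k _ _; apply: integral_ge0 => x _; rewrite lee_fin.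
  apply: nearW => n; rewrite (eq_bigr (fun k => (expect (F k))%:E)); last first.
    by move=> k _; rewrite expect_EFin.
  by rewrite big_mkord sumEFin lee_fin.
have IPhi : mu.-integrable setT Phi.
  apply/integrableP; split => //.
  under eq_integral => x _ do rewrite gee0_abs //.
  by rewrite (le_lt_trans iPhi) // ltry.
apply: (ae_imply (integrable_ae measurableT IPhi)) => x /(_ I) fx.
apply: cvg_series_cvg_0; apply: nnseries_is_cvg => //.
by move: fx; rewrite ge0_fin_numE.
Qed.

End SelfSimilarSupport.

(** * The convex hull of the self-similar set and derivatives inside it *)

Section Geometry.
Variable R : realType.
Implicit Types (X : set R).

Lemma compact_range X : X !=set0 -> compact X ->
  exists al be : R, [/\ X al, X be & forall x, X x -> al <= x <= be].
Proof.
move=> X0 cX.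
have cid : {within X, continuous (fun x : R => x)} by apply: continuous_subspaceT => x; exact: cvg_id.
have [be /set_mem Xbe Hbe] := compact_EVT_max X0 cX cid.
have [al /set_mem Xal Hal] := compact_EVT_min X0 cX cid.
exists al, be; split=> // x Xx; apply/andP; split; first by apply: Hal; exact/mem_set.
by apply: Hbe; exact/mem_set.
Qed.

Lemma convex_hull_range X al be : X al -> X be ->
  (forall x, X x -> al <= x <= be) ->
  forall y, convex_hull X y <-> al <= y <= be.
Proof.
move=> Xal Xbe Xb y; split.
  apply: (@smallest_sub _ (@convex_set R R^o) X [set z | al <= z <= be]) => //.
  move=> u v l /set_mem /= /andP[u1 u2] /set_mem /= /andP[v1 v2]; apply/mem_set => /=.
  have l0 : 0 <= l%:num by [].
  have l1 : l%:num <= 1 by [].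
  change (al <= l%:num * u + (1 - l%:num) * v <= be).
  by apply/andP; split; nra.
move=> /andP[y1 y2] B [cB XB].
have Bal : B al by exact: XB.
have Bbe : B be by exact: XB.
have [abE|ab] := eqVneq al be.
  by have -> : y = al by apply/eqP; rewrite eq_le y1 abE y2.
have lt_ab : 0 < be - al by rewrite subr_gt0 lt_neqAle ab (le_trans y1).
pose l := (be - y) / (be - al).
have l0 : 0 <= l by apply: divr_ge0; [rewrite subr_ge0|exact: ltW].
have l1 : l <= 1 by rewrite ler_pdivrMr // mul1r; lra.
have /set_mem := cB al be (Itv01 l0 l1) (mem_set Bal) (mem_set Bbe).
change (B (l * al + (1 - l) * be) -> B y); congr B.
by rewrite /l; field; rewrite gt_eqF.
Qed.

Variables (A : finType) (r : R) (t : A -> R) (X : set R) (al be : R).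
Hypothesis hX : is_self_similar_set (equicontractive_ifs r t) X.
Hypothesis Xal : X al.
Hypothesis Xbe : X be.
Hypothesis Xb : forall x, X x -> al <= x <= be.

Lemma ifs_maps_hull i y : al <= y <= be -> al <= r * y + t i <= be.
Proof.
case: hX => _ _ XE yab; have XI x : X x -> al <= r * x + t i <= be.
  by move=> Xx; apply: Xb; rewrite XE; exists i => //; exists x.
have /andP[a1 a2] := XI _ Xal; have /andP[b1 b2] := XI _ Xbe.
by move/andP: yab => [y1 y2]; case: (leP 0 r) => r0; apply/andP; split; nra.
Qed.

(** The images of [al, be] under i and j are translates of an interval of length |r| (be - al);
    they are disjoint exactly when the translation t i - t j is longer than that. As A is finite,
    the least excess is positive. *)
Lemma hull_gap : convex_strong_separation (equicontractive_ifs r t) X ->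
  exists2 d0 : R, 0 < d0 &
    forall i j, i != j -> `|r| * (be - al) + d0 <= `|t i - t j|.
Proof.
move=> hsep.
have HE := convex_hull_range Xal Xbe Xb.
have ab : al <= be by case/andP: (Xb Xbe).
have pos i j : i != j -> 0 < `|t i - t j| - `|r| * (be - al).
  move=> ij; rewrite subr_gt0 ltNge; apply/negP => le_t.
  have [x [y [xH yH E]]] : exists x y, [/\ al <= x <= be, al <= y <= be & r * x + t i = r * y + t j].
    have sep s : `|s| <= `|r| * (be - al) -> exists x y, [/\ al <= x <= be, al <= y <= be & s = r * (y - x)].
      move=> sb; have [r0|r0] := eqVneq r 0.
        exists al, al; rewrite lexx ab; split=> //.
        by apply/eqP; rewrite r0 mul0r -normr_le0; rewrite r0 normr0 mul0r in sb.
      have q : `|s / r| <= be - al.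
        by rewrite normrM normfV ler_pdivrMr ?normr_gt0 // mulrC.
      move: q; rewrite ler_norml => /andP[q1 q2].
      have [q0|q0] := leP 0 (s / r).
        exists al, (al + s / r); split; [by rewrite lexx ab|by apply/andP; split; lra|].
        by field.
      exists (al - s / r), al; split; [by apply/andP; split; lra|by rewrite lexx ab|].
      by field.
    have [x [y [xH yH E]]] := sep _ le_t; exists x, y; split=> //.
    by apply/eqP; rewrite -subr_eq0 -[X in _ == X](subrr (t i - t j)) {2}E; apply/eqP; ring.
  have := hsep i j ij; rewrite -subset0 => /(_ (r * x + t i)); apply; split.
    by exists x => //; apply/HE.
  by exists y; [apply/HE|].
pose F (ij : A * A) := if ij.1 != ij.2 then `|t ij.1 - t ij.2| - `|r| * (be - al) else 1.
pose d0 := \big[Num.min/1]_ij F ij.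
have F0 ij : 0 < F ij by rewrite /F; case: ifP => // /pos.
exists d0; first by rewrite /d0; elim/big_ind: _ => // a b a0 b0; rewrite lt_min a0.
move=> i j ij; have : d0 <= F (i, j) by exact: bigmin_le_cond.
by rewrite /F /= ij; lra.
Qed.

End Geometry.

Section DerivativesOnHull.
Variable R : realType.

(** At an interior point of D the restriction to D in the difference quotient is harmless. *)
Lemma derive_on_is_derive (D : set R) (g : R -> R) (al be x : R) :
  (forall y, al < y < be -> D y) -> differentiable_on D g -> al < x < be ->
  is_derive x 1 g (derive_on D g x).
Proof.
move=> DI dg xI; have /andP[x1 x2] := xI.
have wE : within D x^' = x^'.
  have FD : x^' D.
    apply: nbhs_dnbhs; have : nbhs x `]al, be[%classic.
      by apply: open_nbhs_nbhs; split; [exact: interval_open|rewrite /= in_itv].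
    by apply: filterS => y; rewrite /= in_itv /=; exact: DI.
  apply/seteqP; split=> U.
    by move=> HU; apply: filterS2 FD HU => y Dy; apply.
  by move=> HU; rewrite /within /=; apply: filterS HU.
have H := dg x (DI x xI); rewrite /derive_on.
have : (g y - g x) / (y - x) @[y --> x^'] --> lim ((g y - g x) / (y - x) @[y --> within D x^']).
  by rewrite wE in H *.
set l := lim _ => cl.
have dl : h^-1 *: (g (h *: (1 : R) + x) - g x) @[h --> 0^'] --> l.
  apply/cvgrPdist_lt => e e0.
  have /cvgrPdist_lt/(_ e e0) := cl.
  rewrite /dnbhs => /nbhs_ballP[d d0 Hd]; apply/nbhs_ballP; exists d => // h hd h0.
  have := Hd (h + x); rewrite /ball /= in hd *.
  rewrite opprD addrCA subrr addr0 addrK => /(_ _ _).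
  rewrite mulrC /GRing.scale /= mulr1; apply.
    by move: hd; rewrite sub0r.
  by rewrite -subr_eq0 addrK.
apply: DeriveDef; first by apply/cvg_ex; exists l.
exact: cvg_lim dl.
Qed.

End DerivativesOnHull.

(** * Auxiliary estimates *)

Section Auxiliary.
Variable R : realType.

(** F3 has constant sign, so F2 is monotone and F2 x lies between the mean slopes of F1 over
    [x - s, x] and [x, x + s]. This bounds the second derivative although only the first one is
    controlled from above. *)
Lemma second_derivative_bound (F1 F2 F3 : R -> R) (x s M : R) : 0 < s ->
  (forall y, x - s <= y <= x + s -> is_derive y 1 F1 (F2 y)) ->
  (forall y, x - s <= y <= x + s -> is_derive y 1 F2 (F3 y)) ->
  (forall y, x - s <= y <= x + s -> `|F1 y| <= M) ->
  (forall y, x - s <= y <= x + s -> 0 <= F3 y) \/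
  (forall y, x - s <= y <= x + s -> F3 y <= 0) ->
  `|F2 x| <= 2 * M / s.
Proof.
move=> s0 D1 D2 B H.
have xJ : x - s <= x <= x + s by apply/andP; split; lra.
have lJ : x - s <= x - s <= x + s by apply/andP; split; lra.
have rJ : x - s <= x + s <= x + s by apply/andP; split; lra.
have [c [/andP[c1 c2] _ Ec]] : exists c, [/\ x <= c <= x + s, `|c - x| <= `|x + s - x| & F1 (x + s) - F1 x = F2 c * (x + s - x)].
  apply: (@mvt_itv R x (x + s)); try by apply/andP; split; lra.
  by move=> y /andP[y1 y2]; apply: D1; apply/andP; split; lra.
have [d [/andP[d1 d2] _ Ed]] : exists c, [/\ x - s <= c <= x, `|c - (x - s)| <= `|x - (x - s)| & F1 x - F1 (x - s) = F2 c * (x - (x - s))].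
  apply: (@mvt_itv R (x - s) x); try by apply/andP; split; lra.
  by move=> y /andP[y1 y2]; apply: D1; apply/andP; split; lra.
have cJ : x - s <= c <= x + s by apply/andP; split; lra.
have dJ : x - s <= d <= x + s by apply/andP; split; lra.
have [c' [c'J _ Ec']] := mvt_itv D2 xJ cJ.
have [d' [d'J _ Ed']] := mvt_itv D2 xJ dJ.
have := B _ xJ; have := B _ lJ; have := B _ rJ; rewrite !ler_norml.
move=> /andP[r1 r2] /andP[l1 l2] /andP[m1 m2].
have sc : s * F2 c <= 2 * M /\ - (2 * M) <= s * F2 c.
  have -> : s * F2 c = F1 (x + s) - F1 x by rewrite Ec; ring.
  by split; lra.
have sd : s * F2 d <= 2 * M /\ - (2 * M) <= s * F2 d.
  have -> : s * F2 d = F1 x - F1 (x - s) by rewrite Ed; ring.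
  by split; lra.
suff : s * F2 x <= 2 * M /\ - (2 * M) <= s * F2 x.
  move=> [u1 u2]; apply/andP; split; last by rewrite ler_pdivlMr //; lra.
  by rewrite -mulNr ler_pdivrMr //; lra.
case: sc => sc1 sc2; case: sd => sd1 sd2.
case: H => H3.
  have T1 : F2 x <= F2 c by rewrite -subr_ge0 Ec' mulr_ge0 ?H3 //; lra.
  have T2 : F2 d <= F2 x by rewrite -subr_le0 Ed' mulr_ge0_le0 ?H3 //; lra.
  by split; [apply: le_trans sc1|apply: (le_trans sd2)]; rewrite ler_wpM2l // ltW.
have T1 : F2 c <= F2 x by rewrite -subr_le0 Ec' mulr_le0_ge0 ?H3 //; lra.
have T2 : F2 x <= F2 d by rewrite -subr_ge0 Ed' mulr_le0 ?H3 //; lra.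
by split; [apply: le_trans sd1|apply: (le_trans sc2)]; rewrite ler_wpM2l // ltW.
Qed.

Lemma is_derive_affine (k a b z d : R) (g : R -> R) :
  is_derive (a * z + b) 1 g d -> is_derive z 1 (fun z => k * g (a * z + b)) (k * (d * a)).
Proof.
move=> Dg.
have Da : is_derive z 1 (fun w : R => a * w + b) a.
  by apply: is_derive_eq; rewrite /GRing.scale /= mulr1 addr0.
have Dc : is_derive z 1 (g \o (fun w : R => a * w + b)) (d * a).
  by have := @is_derive1_comp R g (fun w : R => a * w + b) z d a Dg Da.
by have := @is_deriveZ R R R (g \o (fun w : R => a * w + b)) k z 1 (d * a) Dc.
Qed.

(** From ln y <= y applied to y = eps n with eps = D / (2 (c + 1)). *)
Lemma powR_le_expR (M c D : R) : 0 <= M -> 0 <= c -> 0 < D ->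
  exists n1 : nat, forall n : nat, (n1 <= n)%N -> M * n%:R `^ c <= expR (D * n%:R).
Proof.
move=> M0 c0 D0; pose e := D / (2 * (c + 1)).
have c1 : 0 < 2 * (c + 1) by lra.
have e0 : 0 < e by rewrite divr_gt0.
have ce : c * e <= D / 2.
  by rewrite /e mulrA ler_pdivrMr //; nra.
pose K := M * expR (- (c * ln e)).
have K0 : 0 <= K by rewrite mulr_ge0 // expR_ge0.
exists (Num.trunc (K / (D / 2))).+1 => n n1.
have n0 : (0 < n)%N by apply: leq_trans n1.
have nR : 0 < n%:R :> R by rewrite ltr0n.
have Kn : K <= expR (D / 2 * n%:R).
  apply: expR_ge_lin; first by rewrite divr_gt0.
  by rewrite ltW // (lt_le_trans (truncnS_gt _)) // ler_nat.
have en0 : 0 < e * n%:R by exact: mulr_gt0.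
have ln_n : ln n%:R <= e * n%:R - ln e.
  have := expR_ge1Dx (ln (e * n%:R)); rewrite lnK ?posrE //.
  by rewrite lnM ?posrE //; lra.
rewrite /powR gt_eqF //.
apply: (@le_trans _ _ (M * expR (D / 2 * n%:R - c * ln e))).
  rewrite ler_wpM2l // ler_expR.
  have := ler_wpM2l c0 ln_n; have := ler_wpM2r (ltW nR) ce.
  lra.
rewrite expRD mulrCA -/K (_ : D * n%:R = D / 2 * n%:R + D / 2 * n%:R); last by field.
by rewrite expRD ler_wpM2l // expR_ge0.
Qed.

(** Telescoping, since 1 / (k+1) ^ 2 <= 2 / (k+1) - 2 / (k+2). *)
Lemma sum_inv_sq_le (n : nat) : \sum_(k < n) (k.+1%:R ^+ 2)^-1 <= 2 - 2 / n.+1%:R :> R.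
Proof.
elim: n => [|n IH]; first by rewrite big_ord0 divr1 subrr.
rewrite big_ord_recr /=.
suff H : (n.+1%:R ^+ 2)^-1 <= 2 / n.+1%:R - 2 / n.+2%:R :> R.
  by rewrite (le_trans (lerD IH H)) // addrA subrK.
have a0 : 0 < n.+1%:R :> R by [].
have -> : n.+2%:R = n.+1%:R + 1 :> R by rewrite natr1.
have a1 : 1 <= n.+1%:R :> R by rewrite ler1n.
move: a0 a1; set a := n.+1%:R => a0 a1.
have a2 : 0 < a + 1 by lra.
have -> : 2 / a - 2 / (a + 1) = 2 / (a * (a + 1)) by field; rewrite !gt_eqF.
rewrite ler_pdivlMr ?mulr_gt0 // mulrC ler_pdivrMr ?exprn_gt0 //.
by nra.
Qed.

Lemma square_between (N : nat) : exists k, (k ^ 2 <= N < k.+1 ^ 2)%N.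
Proof.
elim: N => [|N [k /andP[k1 k2]]]; first by exists 0%N.
have [H|H] := ltnP N.+1 (k.+1 ^ 2); first by exists k; rewrite H (leq_trans k1).
by exists k.+1; rewrite H (leq_ltn_trans k2) // ltn_sqr.
Qed.

(** Between k ^ 2 and (k+1) ^ 2 the partial sums move by at most 2 k, negligible
    compared to k ^ 2. *)
Lemma cvg_mean_squares (a : nat -> R) : (forall n, `|a n| <= 1) ->
  (\sum_(1 <= n < (k.+1 ^ 2).+1) a n) / (k.+1 ^ 2)%:R @[k --> \oo] --> (0 : R) ->
  (\sum_(1 <= n < N.+1) a n) / N%:R @[N --> \oo] --> (0 : R).
Proof.
move=> a1 H; apply/cvgrPdist_le => e e0.
move/cvgrPdist_le : H => /(_ (e / 2)); rewrite divr_gt0 // => /(_ isT) [k0 _ Hk].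
pose k1 := (Num.trunc (4 / e)).+1.
exists ((maxn k0.+1 k1) ^ 2)%N => // N /= HN.
have [k /andP[kN Nk]] := square_between N.
have kk : (maxn k0.+1 k1 <= k)%N.
  by rewrite -ltnS -ltn_sqr (leq_ltn_trans HN).
move: kk; rewrite geq_max => /andP[kk0 kk1].
have k_gt0 : (0 < k)%N by apply: leq_trans kk0.
have kR : 0 < k%:R :> R by rewrite ltr0n.
have N0 : (0 < N)%N by apply: leq_trans kN; rewrite expn_gt0 k_gt0.
have NR : 0 < N%:R :> R by rewrite ltr0n.
have := Hk k.-1; rewrite /= -ltnS prednK // => /(_ kk0).
rewrite !sub0r !normrN => HS.
have k2R : 0 < (k ^ 2)%:R :> R by rewrite ltr0n expn_gt0 k_gt0.
have kNR : (k ^ 2)%:R <= N%:R :> R by rewrite ler_nat.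
rewrite normrM normfV (gtr0_norm k2R) ler_pdivrMr // in HS.
rewrite normrM normfV (gtr0_norm NR) ler_pdivrMr //.
rewrite (big_cat_nat _ (n := (k ^ 2).+1)) //=.
rewrite (le_trans (ler_normD _ _)) //.
have T : `|\sum_((k ^ 2).+1 <= i < N.+1) a i| <= 2 * k%:R.
  rewrite (le_trans (ler_norm_sum _ _ _)) //.
  apply: (@le_trans _ _ (\sum_((k ^ 2).+1 <= i < N.+1) 1)); first by apply: ler_sum.
  rewrite sumr_const_nat subSS -natrM ler_nat.
  by move: Nk; rewrite !expnS !expn0 !muln1; lia.
have ke : 2 * k%:R <= e / 2 * (k ^ 2)%:R.
  have : 4 / e <= k%:R.
    by rewrite ltW // (lt_le_trans (truncnS_gt _)) // ler_nat.
  rewrite ler_pdivrMr // natrX; nra.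
have := ler_wpM2l (ltW e0) kNR; lra.
Qed.

End Auxiliary.

(** * Decay of the correlations on small cylinders *)

Section DecayOnWord.
Variables (R : realType) (A : finType) (r : R) (t : A -> R) (p : A -> R).
Variable mu : probability (measurableTypeR R) R.
Hypothesis hp : probability_vector p.
Hypothesis hmu : is_self_similar_measure (equicontractive_ifs r t) p mu.
Variables (al be d0 : R).
Hypothesis r0 : 0 < `|r|.
Hypothesis r1 : `|r| < 1.
Hypothesis ab : al <= be.
Hypothesis phiH : forall i y, al <= y <= be -> al <= r * y + t i <= be.
Hypothesis d0_gt0 : 0 < d0.
Hypothesis gap : forall i j, i != j -> `|r| * (be - al) + d0 <= `|t i - t j|.
Hypothesis hent : 1 / 2 < entropy p / - ln `|r|.
Hypothesis al1 : 1 <= al.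

Variables f f1 f2 f3 : nat -> R -> R.
Hypothesis Df0 : forall n x, (0 < n)%N -> al < x < be -> is_derive x 1 (f n) (f1 n x).
Hypothesis Df1 : forall n x, (0 < n)%N -> al < x < be -> is_derive x 1 (f1 n) (f2 n x).
Hypothesis Df2 : forall n x, (0 < n)%N -> al < x < be -> is_derive x 1 (f2 n) (f3 n x).
Variables (C1 C2 C3 : R) (n0 : nat).
Hypothesis C1_gt0 : 0 < C1.
Hypothesis C2_gt0 : 0 < C2.
Hypothesis C3_gt0 : 0 < C3.
Hypothesis condB : forall m n x, (0 < m)%N -> (m < n)%N -> al < x < be ->
  `|f1 n x - f1 m x| <= C1 * (n%:R `^ C2) * x ^+ (n - 1).
Hypothesis condC : forall m n x, (n0 <= n)%N -> (0 < m)%N -> (m < n)%N -> al < x < be ->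
  C3 * x ^+ (n - 2) <= `|f2 n x - f2 m x|.
Hypothesis condD : forall m n, (0 < m)%N -> (m < n)%N ->
  (forall x, al < x < be -> 0 <= f3 n x - f3 m x) \/
  (forall x, al < x < be -> f3 n x - f3 m x <= 0).

(** The functions are only controlled inside the hull; extending them by 0 makes them
    measurable on the whole line without changing them almost everywhere. *)
Definition inner (n : nat) : measurableTypeR R -> measurableTypeR R :=
  (f n : measurableTypeR R -> measurableTypeR R) \_ `]al, be[%classic.

Lemma innerE n x : al < x < be -> inner n x = f n x.
Proof. by move=> xI; rewrite /inner patchE mem_set //= in_itv. Qed.

Lemma measurable_inner n : (0 < n)%N -> measurable_fun [set: measurableTypeR R] (inner n).
Proof.
move=> n0'; apply: (measurable_restrictT _ _).1; first exact: measurable_itv.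
apply: open_continuous_measurable_fun; first exact: interval_open.
move=> x /set_mem /=; rewrite in_itv /= => xI.
apply: differentiable_continuous; apply/derivable1_diffP.
by apply: ex_derive; exact: Df0.
Qed.

Lemma bm_ecos (G : measurableTypeR R -> measurableTypeR R) :
  measurable_fun [set: measurableTypeR R] G -> bounded_measurable (fun x => ecos (G x)).
Proof.
move=> mG; split; last by exists 1 => x; exact: ecos_abs_le1.
have mc : measurable_fun [set: measurableTypeR R] ((fun x => ecos x) : measurableTypeR R -> measurableTypeR R).
  apply: continuous_measurable_fun => x; rewrite /ecos.
  apply: (@continuous_comp _ _ _ (fun x : R => 2 * pi * x) cos); last exact: continuous_cos.
  by apply: cvgMl_tmp; exact: cvg_id.
exact: (measurableT_comp mc mG).
Qed.

Lemma expect_abs_le F B : bounded_measurable F ->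
  (forall x, al <= x <= be -> `|F x| <= B) -> `|expect mu F| <= B.
Proof.
move=> bF FB; rewrite ler_norml; apply/andP; split.
  rewrite -(expect_cst mu (- B)); apply: (expect_le_H hp hmu r0 r1 ab phiH) => [||x xH] //; first exact: bm_cst.
  by have := FB x xH; rewrite ler_norml => /andP[].
rewrite -(expect_cst mu B); apply: (expect_le_H hp hmu r0 r1 ab phiH) => [||x xH] //; first exact: bm_cst.
by have := FB x xH; rewrite ler_norml => /andP[].
Qed.

(** Words map [al, be] into itself. *)
Lemma average_eqH k F G : (forall y, al <= y <= be -> F y = G y) ->
  forall y, al <= y <= be -> average r t p k F y = average r t p k G y.
Proof.
move=> FG y yH; apply: eq_bigr => u _; congr (_ * _).
by apply: FG; exact: word_map_in.
Qed.

Definition phase (l m n K : nat) (w : word A K) (x : R) : R :=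
  l%:R * (inner n (word_map r t w x) - inner m (word_map r t w x)).

Lemma bm_phase l m n K (w : word A K) : (0 < m)%N -> (0 < n)%N ->
  bounded_measurable (fun x => ecos (phase l m n w x)).
Proof.
move=> m_gt0 n_gt0.
pose G (x : measurableTypeR R) : measurableTypeR R := l%:R * (inner n x - inner m x).
have mG : measurable_fun [set: measurableTypeR R] G.
  apply: measurable_funM; first exact: measurable_cst.
  by apply: measurable_funB; exact: measurable_inner.
exact: (bm_comp (r ^+ K) (tau r t w) (bm_ecos mG)).
Qed.

(** Along a long word the cylinder lies in a short interval [a, b] kept away from the
    endpoints of [al, be]. There x ^ n varies between a ^ n and b ^ n with ln a and ln b nearly
    equal, so that a single size exp(B n) serves as upper bound for the first two derivatives of the
    phase and, raised to the power 1 - e, as lower bound for the second.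
    Then [oscillatory_decay] applies. *)
Lemma decay_on_word (l : nat) (kappa : R) : (0 < l)%N -> 0 < kappa ->
  exists K : nat, forall (w : word A K) (y0 : R), al <= y0 <= be ->
    al + kappa <= word_map r t w y0 <= be - kappa ->
  exists2 C : R, 0 <= C & forall m n, (0 < m)%N -> (m < n)%N ->
    `|expect mu (fun x => ecos (phase l m n w x))| <= C / n%:R.
Proof.
move=> l0 kap0; have al_ge1 := al1.
have [e [c [C0 [x0 [e0 e1 c0 C00 decay]]]]] := oscillatory_decay r0 r1 ab phiH d0_gt0 gap hp hent.
have ee : (1 - e) * (1 + e / 4) + e / 2 <= 1 - e / 4 by have := sqr_ge0 e; lra.
have inner_itv (z s y : R) : 0 < s -> s <= kappa / 4 -> al + kappa <= z -> z <= be - kappa ->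
    `|y - z| <= 2 * s -> [/\ al < y < be, z - s - s <= y & y <= z + 2 * s].
  move=> s0 s1 z1 z2; rewrite ler_distl => /andP[y1 y2].
  by split; [apply/andP; split| |]; lra.
have lR : 0 < l%:R :> R by rewrite ltr0n.
pose k0 := ln (1 + kappa / 2).
have k0_gt0 : 0 < k0 by rewrite ln_gt0 // ltrDl divr_gt0.
(* kappa / 4 keeps the enlarged cylinder inside the hull, the other term keeps ln a and ln b
   within a factor 1 - e / 4 *)
pose s := Num.min (kappa / 4) (e * k0 / 12).
have s0 : 0 < s.
  by rewrite lt_min; apply/andP; split; apply: divr_gt0 => //; apply: mulr_gt0.
have s1 : s <= kappa / 4 by rewrite ge_min lexx.
have s2 : s <= e * k0 / 12 by rewrite ge_min lexx orbT.
pose Lh := be - al.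
have Lh0 : 0 <= Lh by rewrite subr_ge0.
have [K HK] : exists K, `|r| ^+ K * Lh <= s.
  have cr : `|r| ^+ k @[k --> \oo] --> (0 : R) by apply: cvg_expr; rewrite normr_id.
  have sL : 0 < s / (Lh + 1) by rewrite divr_gt0 // ltr_wpDl.
  have [K _ HK] := cvgr_lt _ cr _ sL.
  exists K; have := HK K (leqnn K); rewrite /= ltr_pdivlMr ?ltr_wpDl // => H.
  by have : 0 <= `|r| ^+ K := exprn_ge0 _ (ltW r0); lra.
exists K => w y0 yH /andP[w1 w2].
pose X0 := word_map r t w y0.
pose a := X0 - s; pose b := X0 + 2 * s.
rewrite -/X0 in w1 w2.
have a1 : 1 <= a by rewrite /a; lra.
have bk : 1 + kappa / 2 <= b by rewrite /b; lra.
have b0 : 0 < b by lra.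
have a0 : 0 < a by lra.
have b1 : 1 <= b by lra.
have ss : s <= 2 * s by rewrite ler_peMl ?(ltW s0) // ler1n.
pose lb := ln b.
have lbk : k0 <= lb by rewrite ler_ln ?posrE //; lra.
have lb0 : 0 < lb by lra.
have lab : (1 - e / 4) * lb <= ln a.
  have H : lb <= ln a + 3 * s.
    rewrite /lb -[X in ln a + X]expRK -lnM ?posrE ?expR_gt0 //.
    rewrite ler_ln ?posrE ?mulr_gt0 ?expR_gt0 //.
    have := expR_ge1Dx (3 * s) => H1.
    have : a * (1 + 3 * s) <= a * expR (3 * s) by rewrite ler_wpM2l // ltW.
    have : 3 * s <= a * (3 * s) by rewrite ler_peMl // mulr_ge0 // ltW.
    by rewrite /a /b; lra.
  have : e * k0 <= e * lb by rewrite ler_wpM2l // ltW.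
  by lra.
have near_X0 z : al <= z <= be -> `|word_map r t w z - X0| <= s.
  move=> zH; rewrite word_mapB normrM normrX (le_trans _ HK) //.
  rewrite ler_wpM2l ?exprn_ge0 ?(ltW r0) // ler_norml.
  by rewrite /Lh; case/andP: zH; case/andP: yH => *; apply/andP; split; lra.
have inJ y : `|y - X0| <= 2 * s -> [/\ al < y < be, a - s <= y & y <= b].
  exact: inner_itv.
have wI z : al <= z <= be -> al < word_map r t w z < be.
  by move=> zH; have [] := inJ (word_map r t w z); first exact: le_trans (near_X0 z zH) ss.
(* the slack e / 4 above ln b absorbs the polynomial factor n ^ C2 *)
pose B := (1 + e / 4) * lb.
have B0 : 0 < B by apply: mulr_gt0 => //; lra.
pose M := l%:R * (1 + 2 / s) * C1.
have M0 : 0 <= M by rewrite !mulr_ge0 ?addr_ge0 ?divr_ge0 ?(ltW s0) ?(ltW C1_gt0).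
have e4 : 0 < e / 4 * lb by apply: mulr_gt0 => //; lra.
have [n1 Hn1] := powR_le_expR M0 (ltW C2_gt0) e4.
pose q := l%:R * (`|r| ^+ K) ^+ 2 * C3 / a ^+ 2.
have q0 : 0 < q by rewrite divr_gt0 ?exprn_gt0 // !mulr_gt0 ?exprn_gt0.
have e2 : 0 < e / 2 * lb by apply: mulr_gt0 => //; lra.
pose n2 := (Num.trunc (q^-1 / (e / 2 * lb))).+1.
pose n3 := (Num.trunc (x0 / B)).+1.
pose nn := maxn (maxn n0 n1) (maxn n2 n3).
have cB : 0 < c * B by exact: mulr_gt0.
exists (C0 / (c * B) + nn%:R); first by rewrite addr_ge0 ?divr_ge0 // ltW.
move=> m n m0 mn; have n_gt0 : (0 < n)%N by apply: leq_trans mn.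
have nR : 0 < n%:R :> R by rewrite ltr0n.
have bF := bm_phase l w m0 n_gt0.
have [nlt|nge] := ltnP n nn.
  apply: (@le_trans _ _ 1).
    by apply: expect_abs_le => // x _; exact: ecos_abs_le1.
  rewrite ler_pdivlMr // mul1r ler_wpDl ?divr_ge0 ?(ltW cB) // ler_nat ltnW //.
move: nge; rewrite !geq_max => /andP[/andP[nn0 nn1] /andP[nn2 nn3]].
have n_ge2 : (2 <= n)%N by apply: leq_ltn_trans mn.
pose F1 y := f1 n y - f1 m y; pose F2 y := f2 n y - f2 m y.
pose Mn := C1 * n%:R `^ C2 * expR (lb * n%:R).
have Mn0 : 0 <= Mn by rewrite !mulr_ge0 ?powR_ge0 ?expR_ge0 // ltW.
have F1b y : `|y - X0| <= 2 * s -> `|F1 y| <= Mn.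
  move=> yJ; have [yI y1 y2] := inJ y yJ.
  apply: (le_trans (condB m0 mn yI)); rewrite ler_wpM2l //.
    by rewrite mulr_ge0 ?powR_ge0 // ltW.
  have y_ge0 : 0 <= y by case/andP: yI => /ltW ya _; rewrite (le_trans _ ya) // (le_trans ler01).
  apply: (@le_trans _ _ (b ^+ (n - 1))); first by rewrite lerXn2r // nnegrE // ltW.
  apply: (@le_trans _ _ (b ^+ n)); first by rewrite ler_weXn2l ?leq_subr.
  by rewrite mulrC expRM_natl lnK ?posrE.
have F2b z : al <= z <= be -> `|F2 (word_map r t w z)| <= 2 * Mn / s.
  move=> zH; have zn := near_X0 z zH.
  have sub y : word_map r t w z - s <= y <= word_map r t w z + s -> `|y - X0| <= 2 * s.
    move=> yz; rewrite mulr_natl mulr2n (le_trans (ler_distD (word_map r t w z) _ _)) //.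
    by rewrite lerD // ler_distl.
  apply: (@second_derivative_bound _ F1 F2 (fun y => f3 n y - f3 m y)) => //.
  - move=> y /sub/inJ[yI _ _]; have ? := Df1 n_gt0 yI; have ? := Df1 m0 yI.
    exact: is_deriveB.
  - move=> y /sub/inJ[yI _ _]; have ? := Df2 n_gt0 yI; have ? := Df2 m0 yI.
    exact: is_deriveB.
  - by move=> y /sub; exact: F1b.
  - by have [H|H] := condD m0 mn; [left|right] => y /sub/inJ[yI _ _]; exact: H.
have F2l z : al <= z <= be -> C3 * a ^+ (n - 2) <= `|F2 (word_map r t w z)|.
  move=> zH; apply: le_trans (condC nn0 m0 mn (wI z zH)).
  rewrite ler_wpM2l ?(ltW C3_gt0) // lerXn2r // ?nnegrE ?(ltW a0) //.
    by case/andP: (wI z zH) => /ltW za _; rewrite (le_trans _ za) // (le_trans ler01).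
  by have := near_X0 z zH; rewrite ler_distl => /andP[].
pose rK := r ^+ K.
have rK1 : `|rK| <= 1 by rewrite normrX exprn_ile1 // ltW.
pose G0 z := l%:R * (f n (rK * z + tau r t w) - f m (rK * z + tau r t w)).
pose G1 z := l%:R * rK * F1 (rK * z + tau r t w).
pose G2 z := l%:R * rK * (F2 (rK * z + tau r t w) * rK).
have DG0 z : al <= z <= be -> is_derive z 1 G0 (G1 z).
  move=> zH; have yI := wI z zH.
  have -> : G1 z = l%:R * (F1 (rK * z + tau r t w) * rK) by rewrite /G1; ring.
  apply: (@is_derive_affine R l%:R rK (tau r t w) z _ (fun y => f n y - f m y)).
  by have ? := Df0 n_gt0 yI; have ? := Df0 m0 yI; exact: is_deriveB.
have DG1 z : al <= z <= be -> is_derive z 1 G1 (G2 z).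
  move=> zH; have yI := wI z zH.
  apply: (@is_derive_affine R (l%:R * rK) rK (tau r t w) z _ F1).
  by have ? := Df1 n_gt0 yI; have ? := Df1 m0 yI; exact: is_deriveB.
have up : l%:R * (1 + 2 / s) * Mn <= expR (B * n%:R).
  have -> : l%:R * (1 + 2 / s) * Mn = M * n%:R `^ C2 * expR (lb * n%:R) by rewrite /M /Mn; ring.
  have -> : B * n%:R = e / 4 * lb * n%:R + lb * n%:R by rewrite /B; ring.
  by rewrite expRD ler_wpM2r ?expR_ge0 // Hn1.
have ds0 : 0 <= 2 / s by rewrite divr_ge0 // ltW.
have BG1 z : al <= z <= be -> `|G1 z| <= expR (B * n%:R).
  move=> zH; apply: le_trans up; rewrite /G1 !normrM (gtr0_norm lR) -!mulrA.
  rewrite ler_wpM2l ?(ltW lR) //; apply: (@le_trans _ _ (1 * Mn)); last first.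
    by rewrite ler_wpM2r // lerDl.
  apply: ler_pM => //; exact: F1b (le_trans (near_X0 z zH) ss).
have BG2 z : al <= z <= be -> `|G2 z| <= expR (B * n%:R).
  move=> zH; apply: le_trans up; rewrite /G2 !normrM (gtr0_norm lR) -!mulrA.
  rewrite ler_wpM2l ?(ltW lR) //; apply: (@le_trans _ _ (1 * (2 * Mn / s * 1))).
    by apply: ler_pM; rewrite ?mulr_ge0 //; apply: ler_pM => //; exact: F2b.
  by rewrite mul1r mulr1 mulrAC ler_wpM2r // lerDr ler01.
have LG2 z : al <= z <= be -> expR ((1 - e) * (B * n%:R)) <= `|G2 z|.
  move=> zH; rewrite /G2 !normrM (gtr0_norm lR).
  apply: (@le_trans _ _ (l%:R * `|rK| * (C3 * a ^+ (n - 2) * `|rK|))); last first.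
    by rewrite ler_wpM2l ?mulr_ge0 ?(ltW lR) // ler_wpM2r // F2l.
  have -> : l%:R * `|rK| * (C3 * a ^+ (n - 2) * `|rK|) = q * expR (ln a * n%:R).
    rewrite [ln a * _]mulrC expRM_natl lnK ?posrE //.
    have -> : a ^+ n = a ^+ (n - 2) * a ^+ 2 by rewrite -exprD subnK.
    by rewrite /q normrX; field; rewrite gt_eqF.
  have qn : q^-1 <= expR (e / 2 * lb * n%:R).
    apply: expR_ge_lin => //; rewrite ltW // (lt_le_trans (truncnS_gt _)) //.
    by rewrite ler_nat.
  rewrite -ler_pdivrMl // mulrC.
  apply: (@le_trans _ _ (expR ((1 - e) * (B * n%:R)) * expR (e / 2 * lb * n%:R))).
    by rewrite ler_wpM2l ?expR_ge0.
  rewrite -expRD ler_expR !mulrA -mulrDl ler_wpM2r ?(ltW nR) //.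
  apply: le_trans lab.
  by rewrite -mulrDl ler_wpM2r ?(ltW lb0).
have xB : x0 <= B * n%:R.
  rewrite mulrC -ler_pdivrMr // ltW // (lt_le_trans (truncnS_gt _)) //.
  by rewrite ler_nat.
have [k Hk] := decay _ xB.
have := Hk G0 G1 G2 DG0 DG1 BG1 BG2 LG2 => bound.
rewrite (expect_average hp hmu k bF) (expect_average hp hmu k); last exact: bm_average.
apply: (@le_trans _ _ (C0 * expR (- (c * (B * n%:R))))).
  apply: expect_abs_le; first by apply: bm_average; exact: bm_average.
  move=> y yH'; rewrite (le_trans _ (bound y yH')) //.
  rewrite (@average_eqH k _ (average r t p k (fun z => ecos (G0 z)))) //.
  apply: average_eqH => z zH; congr ecos.
  by rewrite /phase /G0 !innerE ?wI.
rewrite mulrDl -[leLHS]addr0 lerD ?divr_ge0 ?(ltW nR) //.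
rewrite mulrA -[leRHS]mulrA ler_wpM2l // -invfM expRN.
rewrite lef_pV2 ?posrE ?expR_gt0 //; last exact: mulr_gt0.
by rewrite (le_trans _ (expR_ge1Dx _)) // lerDr.
Qed.

End DecayOnWord.

(** * The second moment of the exponential sums and almost sure equidistribution *)

Section AlmostEverywhere.
Variables (R : realType) (A : finType) (r : R) (t : A -> R) (p : A -> R).
Variable mu : probability (measurableTypeR R) R.
Hypothesis hp : probability_vector p.
Hypothesis hmu : is_self_similar_measure (equicontractive_ifs r t) p mu.
Variables (al be d0 : R).
Hypothesis r0 : 0 < `|r|.
Hypothesis r1 : `|r| < 1.
Hypothesis ab : al <= be.
Hypothesis phiH : forall i y, al <= y <= be -> al <= r * y + t i <= be.
Hypothesis d0_gt0 : 0 < d0.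
Hypothesis gap : forall i j, i != j -> `|r| * (be - al) + d0 <= `|t i - t j|.
Hypothesis hent : 1 / 2 < entropy p / - ln `|r|.
Hypothesis al1 : 1 <= al.

Variables f f1 f2 f3 : nat -> R -> R.
Hypothesis Df0 : forall n x, (0 < n)%N -> al < x < be -> is_derive x 1 (f n) (f1 n x).
Hypothesis Df1 : forall n x, (0 < n)%N -> al < x < be -> is_derive x 1 (f1 n) (f2 n x).
Hypothesis Df2 : forall n x, (0 < n)%N -> al < x < be -> is_derive x 1 (f2 n) (f3 n x).
Variables (C1 C2 C3 : R) (n0 : nat).
Hypothesis C1_gt0 : 0 < C1.
Hypothesis C2_gt0 : 0 < C2.
Hypothesis C3_gt0 : 0 < C3.
Hypothesis condB : forall m n x, (0 < m)%N -> (m < n)%N -> al < x < be ->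
  `|f1 n x - f1 m x| <= C1 * (n%:R `^ C2) * x ^+ (n - 1).
Hypothesis condC : forall m n x, (n0 <= n)%N -> (0 < m)%N -> (m < n)%N -> al < x < be ->
  C3 * x ^+ (n - 2) <= `|f2 n x - f2 m x|.
Hypothesis condD : forall m n, (0 < m)%N -> (m < n)%N ->
  (forall x, al < x < be -> 0 <= f3 n x - f3 m x) \/
  (forall x, al < x < be -> f3 n x - f3 m x <= 0).

Notation inner := (inner al be f).

(** Squared modulus of the exponential sum at frequency l, in expanded form. *)
Definition weyl_sq (l N : nat) (x : R) : R :=
  \sum_(i < N) \sum_(j < N) ecos (l%:R * (inner i.+1 x - inner j.+1 x)).

Lemma weyl_sqE l N x : weyl_sq l N x =
  (\sum_(1 <= n < N.+1) ecos (l%:R * inner n x)) ^+ 2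
  + (\sum_(1 <= n < N.+1) esin (l%:R * inner n x)) ^+ 2.
Proof.
rewrite !big_add1 /= !big_mkord.
have := @sq_expsum R _ (index_enum 'I_N) xpredT (fun=> 1) (fun n : 'I_N => l%:R * inner n.+1 x).
under eq_bigr do rewrite mul1r; under [in X in _ + X ^+ 2]eq_bigr do rewrite mul1r.
move=> ->; apply: eq_bigr => i _; apply: eq_bigr => j _.
by rewrite !mul1r mulrBr.
Qed.

Lemma weyl_sq_ge0 l N x : 0 <= weyl_sq l N x.
Proof. by rewrite weyl_sqE addr_ge0 ?sqr_ge0. Qed.

Lemma bm_weyl_sq l N : bounded_measurable (weyl_sq l N).
Proof.
apply: bm_sum => i; apply: bm_sum => j.
have mi n : measurable_fun [set: measurableTypeR R] (inner n.+1).
  by apply: (measurable_inner Df0).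
apply: (@bm_ecos _ (fun x => l%:R * (inner i.+1 x - inner j.+1 x))).
apply: measurable_funM; first exact: measurable_cst.
by apply: measurable_funB; exact: mi.
Qed.

(** Row and column number N together contribute at most 1 + 2 N C / (N+1). *)
Lemma double_sum_le (a : nat -> nat -> R) (C : R) : 0 <= C ->
  (forall i, a i i <= 1) ->
  (forall i j, (i < j)%N -> a i j <= C / j.+1%:R /\ a j i <= C / j.+1%:R) ->
  forall N, \sum_(i < N) \sum_(j < N) a i j <= (1 + 2 * C) * N%:R.
Proof.
move=> C0 adiag aoff; elim=> [|N IH]; first by rewrite big_ord0 mulr0.
rewrite big_ord_recr /=; under eq_bigr do rewrite big_ord_recr /=.
rewrite big_split /= [X in _ + X]big_ord_recr /=.
have NR : 0 < N.+1%:R :> R by [].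
have half (b : nat -> R) : (forall j, (j < N)%N -> b j <= C / N.+1%:R) ->
    \sum_(j < N) b j <= C.
  move=> H; apply: (@le_trans _ _ (\sum_(j < N) C / N.+1%:R)).
    by apply: ler_sum => j _; exact: H.
  rewrite sumr_const card_ord -[leLHS]mulr_natl mulrA ler_pdivrMr // mulrC.
  by rewrite ler_wpM2l // ler_nat.
have h1 : \sum_(i < N) a i N <= C.
  by apply: (half (fun i => a i N)) => i iN; case: (aoff _ _ iN).
have h2 : \sum_(j < N) a N j <= C.
  by apply: (half (fun j => a N j)) => j jN; case: (aoff _ _ jN).
have := adiag N; move: h1 h2 IH; rewrite -[N.+1%:R]natr1.
by move=> *; rewrite mulrDr mulr1; lra.
Qed.

(** Every interior point of [al, be] lies in some window, whereas a window meets only cylinders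
    on which [decay_on_word] holds. *)
Definition window (kappa : R) : set (measurableTypeR R) := `[al + kappa, be - kappa]%classic.

Lemma measurable_window kappa : measurable (window kappa).
Proof. exact: measurable_itv. Qed.

Lemma windowE kappa (x : R) : (\1_(window kappa) x : R) = (al + kappa <= x <= be - kappa)%R%:R.
Proof.
rewrite indicE; congr (nat_of_bool _)%:R; apply/idP/idP.
  by move/set_mem; rewrite /window /= in_itv.
by move=> H; apply/mem_set; rewrite /window /= in_itv.
Qed.

(** Cut the measure into cylinders of level K: those that miss the window do not contribute,
    and on the others the off-diagonal correlations are O(1 / max(m, n)). *)
Lemma second_moment (l : nat) (kappa : R) : (0 < l)%N -> 0 < kappa ->
  exists C : R, forall N,
    expect mu (fun x => \1_(window kappa) x * weyl_sq l N x) <= C * N%:R.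
Proof.
move=> l0 k0.
have [K HK] := decay_on_word hp hmu r0 r1 ab phiH d0_gt0 gap hent al1 Df0 Df1 Df2
  C1_gt0 C2_gt0 C3_gt0 condB condC condD l0 k0.
have b1 := bm_indic (measurable_window kappa).
have bW N : bounded_measurable (fun x => \1_(window kappa) x * weyl_sq l N x) by apply: bmM => //; exact: bm_weyl_sq.
have key (w : word A K) : exists D : R, forall N,
    expect mu (fun x => \1_(window kappa) (word_map r t w x) * weyl_sq l N (word_map r t w x)) <= D * N%:R.
  have bw N : bounded_measurable (fun x => \1_(window kappa) (word_map r t w x) * weyl_sq l N (word_map r t w x)).
    exact: (bm_comp (r ^+ K) (tau r t w) (bW N)).
  have bh N : bounded_measurable (fun x => weyl_sq l N (word_map r t w x)).
    exact: (bm_comp (r ^+ K) (tau r t w) (bm_weyl_sq l N)).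
  have [[y0 [yH yw]]|no] := pselect (exists y0, al <= y0 <= be /\ al + kappa <= word_map r t w y0 <= be - kappa).
    have [C C0 HC] := HK w y0 yH yw.
    exists (1 + 2 * C) => N.
    apply: (@le_trans _ _ (expect mu (fun x => weyl_sq l N (word_map r t w x)))).
      apply: (expect_le_H hp hmu r0 r1 ab phiH) => // x _.
      by rewrite ler_piMl ?weyl_sq_ge0 // windowE lern1 leq_b1.
    pose a i j := expect mu (fun x => ecos (phase r t al be f l j.+1 i.+1 w x)).
    have bp i j : bounded_measurable (fun x => ecos (phase r t al be f l j.+1 i.+1 w x)).
      exact: (bm_phase r t Df0).
    have -> : expect mu (fun x => weyl_sq l N (word_map r t w x)) = \sum_(i < N) \sum_(j < N) a i j.
      rewrite /weyl_sq expect_sum; last by move=> i; apply: bm_sum => j; exact: bp.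
      by apply: eq_bigr => i _; rewrite expect_sum // => j; exact: bp.
    apply: double_sum_le => // [i|i j ij].
      rewrite -(expect_cst mu 1); apply: (expect_le_H hp hmu r0 r1 ab phiH) => [||x _]; [exact: bp|exact: bm_cst|].
      exact: ecos_le1.
    have H : `|a j i| <= C / j.+1%:R by apply: HC.
    have aE : a i j = a j i.
      by congr expect; apply/funext => x; rewrite -ecosN; congr ecos; rewrite /phase; ring.
    by rewrite aE; split; exact: le_trans (ler_norm _) H.
  exists 0 => N; rewrite mul0r -(expect_cst mu 0).
  apply: (expect_le_H hp hmu r0 r1 ab phiH) => // [|x xH]; first exact: bm_cst.
  have nW : (al + kappa <= word_map r t w x <= be - kappa) = false.
    by apply/negP => xw; apply: no; exists x.
  by rewrite windowE nW mul0r.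
have [D HD] := choice key.
exists (\sum_(w : word A K) wprod p w * D w) => N.
rewrite (expect_average hp hmu K (bW N)) /average expect_sum; last first.
  move=> w; apply: bmM; first exact: bm_cst.
  exact: (bm_comp (r ^+ K) (tau r t w) (bW N)).
rewrite mulr_suml; apply: ler_sum => w _; rewrite expectZ; last first.
  exact: (bm_comp (r ^+ K) (tau r t w) (bW N)).
by rewrite -mulrA ler_wpM2l // wprod_ge0 //; exact: pv_ge0.
Qed.

(** Along squares the normalized second moments are O(1 / k ^ 2), which is summable. *)
Lemma squares_ae (l : nat) (kappa : R) : (0 < l)%N -> 0 < kappa ->
  {ae mu, forall x, \1_(window kappa) x * weyl_sq l (k.+1 ^ 2) x / ((k.+1 ^ 2)%:R ^+ 2)
    @[k --> \oo] --> (0 : R)}.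
Proof.
move=> l0 k0; have [C HC] := second_moment l0 k0.
pose F k x : R := \1_(window kappa) x * weyl_sq l (k.+1 ^ 2) x / ((k.+1 ^ 2)%:R ^+ 2).
have bW k : bounded_measurable (fun x => \1_(window kappa) x * weyl_sq l (k.+1 ^ 2) x).
  by apply: bmM; [apply: bm_indic; exact: measurable_window|exact: bm_weyl_sq].
have C0 : 0 <= C.
  have := HC 1%N; rewrite mulr1; apply: le_trans; apply: expect_ge0 => x.
  by rewrite mulr_ge0 ?weyl_sq_ge0 // windowE.
apply: (@borel_cantelli_ae _ _ F (2 * C)) => [k|k x|n].
- by apply: bmM => //; exact: bm_cst.
- by rewrite /F !mulr_ge0 ?invr_ge0 ?weyl_sq_ge0 // windowE.
apply: (@le_trans _ _ (\sum_(k < n) C * (k.+1%:R ^+ 2)^-1)).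
  apply: ler_sum => k _; rewrite /F.
  have kR : 0 < (k.+1 ^ 2)%:R :> R by rewrite ltr0n expn_gt0.
  have -> : expect mu (fun x => \1_(window kappa) x * weyl_sq l (k.+1 ^ 2) x / (k.+1 ^ 2)%:R ^+ 2)
      = (k.+1 ^ 2)%:R ^- 2 * expect mu (fun x => \1_(window kappa) x * weyl_sq l (k.+1 ^ 2) x).
    by rewrite -expectZ //; congr expect; apply/funext => x; rewrite mulrC.
  rewrite mulrC ler_pdivrMr ?exprn_gt0 // (le_trans (HC _)) // -mulrA ler_wpM2l //.
  by rewrite natrX in kR *; rewrite expr2 mulKf ?gt_eqF.
rewrite -mulr_sumr mulrC ler_wpM2r // (le_trans (sum_inv_sq_le R n)) //.
by rewrite gerBl.
Qed.

Lemma sqr_cvg0 (u v : nat -> R) : (forall k, u k ^+ 2 <= v k) ->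
  v @ \oo --> (0 : R) -> u @ \oo --> (0 : R).
Proof.
move=> uv v0; apply/cvgrPdist_lt => e e0.
have e2 : 0 < e ^+ 2 by rewrite exprn_gt0.
near=> k; rewrite sub0r normrN.
have vk : v k < e ^+ 2 by near: k; exact: (cvgr_lt _ v0).
rewrite -(ltr_pXn2r (_ : 0 < 2)%N) ?nnegrE ?(ltW e0) //.
by rewrite real_normK ?num_real // (le_lt_trans (uv k)).
Unshelve. all: by end_near. Qed.

(** Countably many null sets are discarded: one for each frequency and each window, the
    complement of [al, be], and the two endpoints. *)
Lemma equidistribution_ae :
  {ae mu, forall x, uniformly_distributed_mod1 (fun n => f n x)}.
Proof.
have lam0 : 0 < - ln `|r| by rewrite oppr_gt0 ln_lt0 // r0 r1.
have h0 : 0 < entropy p.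
  have : 0 < entropy p / - ln `|r| by apply: lt_trans hent; lra.
  by rewrite pmulr_lgt0 // invr_gt0.
have j0 (j : nat) : 0 < j.+1%:R^-1 :> R by rewrite invr_gt0.
have all_ae : {ae mu, forall x, forall l j : nat,
    \1_(window j.+1%:R^-1) x * weyl_sq l.+1 (k.+1 ^ 2) x / ((k.+1 ^ 2)%:R ^+ 2) @[k --> \oo] --> (0 : R)}.
  apply: ae_foralln => l; apply: ae_foralln => j.
  exact: squares_ae.
have supp := support_ae hp hmu r0 r1 ab phiH.
have atom (z : R) : mu.-negligible ([set z] : set (measurableTypeR R)).
  apply/negligibleP; first exact: measurable_set1.
  exact: (atomless hp hmu r0 r1 ab phiH d0_gt0 gap h0).
have := negligibleU (negligibleU all_ae supp) (negligibleU (atom al) (atom be)).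
apply: negligibleS => x /= nx; apply: contrapT => nbad; apply: nx.
have Hx : forall l j : nat, \1_(window j.+1%:R^-1) x * weyl_sq l.+1 (k.+1 ^ 2) x / ((k.+1 ^ 2)%:R ^+ 2) @[k --> \oo] --> (0 : R).
  by apply: contrapT => H; apply: nbad; left; left.
have /andP[xa xb] : al <= x <= be.
  by apply: contrapT => H; apply: nbad; left; right.
have xal : x != al by apply/eqP => H; apply: nbad; right; left.
have xbe : x != be by apply/eqP => H; apply: nbad; right; right.
have xI : al < x < be by rewrite !lt_neqAle xa xb (eq_sym al) xal xbe.
pose kap := Num.min (x - al) (be - x).
have kap0 : 0 < kap by rewrite lt_min !subr_gt0.
pose j := Num.trunc kap^-1.
have jk : j.+1%:R^-1 <= kap.
  by rewrite -[leRHS]invrK lef_pV2 ?posrE ?invr_gt0 // ltW // truncnS_gt.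
have k1 : kap <= x - al by rewrite ge_min lexx.
have k2 : kap <= be - x by rewrite ge_min lexx orbT.
have xW : (\1_(window j.+1%:R^-1) x : R) = 1.
  rewrite windowE; suff -> : al + j.+1%:R^-1 <= x <= be - j.+1%:R^-1 by [].
  by move: (j.+1%:R^-1) jk => i jk; apply/andP; split; lra.
have main l : (0 < l)%N ->
    (\sum_(1 <= n < N.+1) ecos (l%:R * f n x)) / N%:R @[N --> \oo] --> (0 : R) /\
    (\sum_(1 <= n < N.+1) esin (l%:R * f n x)) / N%:R @[N --> \oo] --> (0 : R).
  case: l => // l _; have := Hx l j; rewrite xW => Hl.
  have E k : 1 * weyl_sq l.+1 (k.+1 ^ 2) x / (k.+1 ^ 2)%:R ^+ 2 =
      ((\sum_(1 <= n < (k.+1 ^ 2).+1) ecos (l.+1%:R * f n x)) / (k.+1 ^ 2)%:R) ^+ 2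
    + ((\sum_(1 <= n < (k.+1 ^ 2).+1) esin (l.+1%:R * f n x)) / (k.+1 ^ 2)%:R) ^+ 2.
    rewrite mul1r weyl_sqE !exprMn !exprVn -mulrDl; congr ((_ ^+ 2 + _ ^+ 2) * _);
      by apply: eq_bigr => n _; rewrite innerE.
  split; apply: cvg_mean_squares.
  - by move=> n; exact: ecos_abs_le1.
  - by apply: sqr_cvg0 Hl => k; rewrite E lerDl sqr_ge0.
  - by move=> n; exact: esin_abs_le1.
  - by apply: sqr_cvg0 Hl => k; rewrite E lerDr sqr_ge0.
by apply: weyl_criterion => l /main[].
Qed.

End AlmostEverywhere.

Theorem theorem2p3 (R : realType) (A : finType) (r : R) (t : A -> R)
  (X : set R) (f : nat -> R -> R) (p : A -> R)
  (mu : probability (measurableTypeR R) R)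
  (hr : (-1 < r < 0) \/ (0 < r < 1))
  (hX : is_self_similar_set (equicontractive_ifs r t) X)
  (hsep : convex_strong_separation (equicontractive_ifs r t) X)
  (hX1 : X `<=` [set x | 1 <= x])
  (condA : forall n : nat, (0 < n)%N ->
    three_times_differentiable_on (convex_hull X) (f n))
  (condB : exists C1 C2 : R, [/\ 0 < C1, 0 < C2 &
    forall m n : nat, (0 < m)%N -> (m < n)%N ->
      forall x, convex_hull X x ->
        `|derive_on_n (convex_hull X) 1 (f n) x
          - derive_on_n (convex_hull X) 1 (f m) x|
        <= C1 * (n%:R `^ C2) * x ^+ (n - 1)])
  (condC : exists2 C3 : R, 0 < C3 &
    exists n0 : nat, forall n : nat, (n0 <= n)%N ->
      forall m : nat, (0 < m)%N -> (m < n)%N ->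
        forall x, convex_hull X x ->
          `|derive_on_n (convex_hull X) 2 (f n) x
            - derive_on_n (convex_hull X) 2 (f m) x|
          >= C3 * x ^+ (n - 2))
  (condD : forall m n : nat, (0 < m)%N -> (m < n)%N ->
    (forall x, convex_hull X x ->
      derive_on_n (convex_hull X) 3 (f n) x
        - derive_on_n (convex_hull X) 3 (f m) x >= 0) \/
    (forall x, convex_hull X x ->
      derive_on_n (convex_hull X) 3 (f n) x
        - derive_on_n (convex_hull X) 3 (f m) x <= 0))
  (hp : probability_vector p)
  (hent : 1 / 2 < entropy p / - ln `|r|)
  (hmu : is_self_similar_measure (equicontractive_ifs r t) p mu) :
  {ae mu, forall x, uniformly_distributed_mod1 (fun n => f n x)}.
Proof.
have [X0 cX XE] := hX.
have [al [be [Xal Xbe Xb]]] := compact_range X0 cX.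
have HE := convex_hull_range Xal Xbe Xb.
have ab : al <= be by case/andP: (Xb _ Xbe).
have phiH := ifs_maps_hull hX Xal Xbe Xb.
have [d0 d0_gt0 gap] := hull_gap Xal Xbe Xb hsep.
have r0 : 0 < `|r| by rewrite normr_gt0; case: hr => /andP[]; lra.
have r1 : `|r| < 1 by rewrite ltr_norml; case: hr => /andP[? ?]; apply/andP; split; lra.
have al1 : 1 <= al := hX1 _ Xal.
have OH x : al < x < be -> convex_hull X x.
  by move=> /andP[x1 x2]; apply/HE; rewrite !ltW.
pose g k n := derive_on_n (convex_hull X) k (f n).
have Dg k n x : (k < 3)%N -> (0 < n)%N -> al < x < be -> is_derive x 1 (g k n) (g k.+1 n x).
  move=> k3 n0 xI; by have := derive_on_is_derive OH (condA _ n0 _ k3) xI.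
have [C1 [C2 [C1_gt0 C2_gt0 HB]]] := condB.
have [C3 C3_gt0 [n0 HC]] := condC.
apply: (@equidistribution_ae R A r t p mu hp hmu al be d0 r0 r1 ab phiH d0_gt0 gap
  hent al1 f (g 1%N) (g 2%N) (g 3%N) _ _ _ C1 C2 C3 n0 C1_gt0 C2_gt0 C3_gt0).
- by move=> n x; exact: (Dg 0%N).
- by move=> n x; exact: (Dg 1%N).
- by move=> n x; exact: (Dg 2%N).
- by move=> m n x m0 mn xI; apply: HB => //; exact: OH.
- by move=> m n x nn0 m0 mn xI; apply: HC => //; exact: OH.
- move=> m n m0 mn; case: (condD _ _ m0 mn) => H; [left|right] => x xI; apply: H; exact: OH.
Qed.
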